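(* Let $R$ be a two-dimensional regular local ring and let $\mathcal C$ be a cluster over $R$. Let $N_{\mathcal C}=(n_{S,T})_{(S,T)\in\mathcal C\times\mathcal C}$ be the intersection matrix $N_{\mathcal C}=-P_{\mathcal C}\,\Delta_{\mathcal C}\,P_{\mathcal C}^{t}$ associated with $\mathcal C$. Then for every $(S,T)\in\mathcal C\times\mathcal C$ the entry $n_{S,T}$ is equal to - $-\Big([S:R]+\sum_{U\in\mathcal C,\ U\succ S}[U:R]\Big)$ if $S=T$; - $[T:R]$ if $T\succ S$ and the point $T^{\ast}\in N_1(T)$ with $S\prec T^{\ast}$ does not belong to the cluster $\mathcal C$; - $[S:R]$ if $S\succ T$ and the point $S^{\ast}\in N_1(S)$ with $T\prec S^{\ast}$ does not belong to the cluster $\mathcal C$; - $0$ otherwise.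
   Context: $R$ is a two-dimensional regular local ring with quotient field $\mathcal K$; $\Omega(R)$ is the set of all two-dimensional regular local subrings of $\mathcal K$ that contain $R$ and have $\mathcal K$ as field of fractions (''points'' infinitely near to $R$). $N_1(S)$ denotes the set of quadratic transforms of $S$, i.e. the local rings at the closed points of the exceptional fibre of the blowing-up of $\mathrm{Spec}(S)$ at its closed point. For $S\subset T$ in $\Omega(R)$ there is a unique finite chain $S=S_0\subsetneqq S_1\subsetneqq\cdots\subsetneqq S_n=T$ with $S_i\in N_1(S_{i-1})$ (the quadratic sequence between $S$ and $T$); $T$ dominates $S$ and $[T:S]:=[k_T:k_S]$ (degree of the residue field extension) is finite. For a point $S$, $V_S\subset\mathcal K$ is the valuation ring of the discrete valuation of $\mathcal K$ extending the order function $\mathrm{ord}_S$ ($\mathrm{ord}_S(f)=m$ iff $f\in\mathfrak m_S^m\setminus\mathfrak m_S^{m+1}$). For points $S\subsetneqq T$, $T$ is proximate to $S$, written $T\succ S$ or $S\prec T$, if $T\subset V_S$ (here $\succ$ is used between distinct points only). For $T \succ S$ there is exactly one $T^\ast\in N_1(T)$ with $T^\ast\succ S$. A cluster over $R$ is a finite subset $\mathcal C\subset\Omega(R)$ with $R\in\mathcal C$ such that whenever $R'\in\mathcal C$, all rings of the quadratic sequence between $R$ and $R'$ belong to $\mathcal C$. The proximity matrix $P_{\mathcal C}=(p_{S,T})_{S,T\in\mathcal C}$ is given by $p_{S,T}=1$ if $S=T$, $p_{S,T}=-1$ if $S\prec T$, and $p_{S,T}=0$ otherwise. $\Delta_{\mathcal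 C}$ is the diagonal matrix indexed by $\mathcal C$ with diagonal entries $[S:R]$. The intersection matrix associated with $\mathcal C$ is $N_{\mathcal C}:=-P_{\mathcal C}\cdot\Delta_{\mathcal C}\cdot P_{\mathcal C}^t$. (It is the matrix of the intersection form in the basis of strict transforms of the exceptional components when $\mathcal C$ comes from a sequence of point blowing-ups.) *)

(* Defs.v *)
From HB Require Import structures.
From mathcomp Require Import all_boot all_order all_algebra.
From mathcomp Require Import finmap all_classical.

Set Implicit Arguments.
Unset Strict Implicit.
Unset Printing Implicit Defensive.

Import GRing.Theory.
Local Open Scope classical_set_scope.
Local Open Scope ring_scope.

(* All rings are subrings of a fixed field K, represented by their carrier
   sets; a point is thus an element of the choiceType [set K], and a cluster is
   a finite set of type [{fset set K}]. *)

Section LocalRings.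
Variable K : fieldType.
Implicit Types (A S I J P : set K) (u x y z w : K) (n d : nat).

Definition is_ideal A I : Prop :=
  [/\ I `<=` A, I 0, (forall x y, I x -> I y -> I (x + y))
    & (forall a x, A a -> I x -> I (a * x))].

Definition is_prime_ideal A P : Prop :=
  [/\ is_ideal A P, ~ P 1
    & forall x y, A x -> A y -> P (x * y) -> P x \/ P y].

Definition is_maximal_ideal A P : Prop :=
  [/\ is_ideal A P, ~ P 1
    & forall J, is_ideal A J -> ~ J 1 -> P `<=` J -> J = P].

Definition generated_ideal A n (g : 'I_n -> K) : set K :=
  [set x | exists2 a : 'I_n -> K, (forall i, A (a i)) & x = \sum_i a i * g i].

Definition noetherian A : Prop :=
  forall I, is_ideal A I ->
    exists n (g : 'I_n -> K), I = generated_ideal A g.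

Definition prime_chain A n : Prop :=
  exists p : nat -> set K,
    (forall i, (i <= n)%N -> is_prime_ideal A (p i)) /\
    (forall i, (i < n)%N -> p i `<` p i.+1).

Definition krull_dim_eq A d : Prop := prime_chain A d /\ ~ prime_chain A d.+1.

(* Since [0^-1 = 0] in MathComp, [x^-1 \in S] would not characterize units. *)
Definition nonunits S : set K :=
  [set x | S x /\ ~ exists2 y, S y & x * y = 1].

Definition local_ring S : Prop :=
  GRing.subring_closed (mem S) /\ is_ideal S (nonunits S).

(* The maximal ideal of S, when S is local. *)
Notation "''m_' S" := (nonunits S) (at level 8, S at level 2, format "''m_' S").

Definition regular_local_ring d S : Prop :=
  [/\ local_ring S, noetherian S, krull_dim_eq S d
    & exists g : 'I_d -> K, 'm_S = generated_ideal S g].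

Definition fraction_field S : Prop :=
  forall u, exists x y, [/\ S x, S y, y != 0 & u = x / y].

Definition Omega (R : set K) : set (set K) :=
  [set T | [/\ regular_local_ring 2 T, fraction_field T & R `<=` T]].

Definition ideal_mul I J : set K :=
  [set x | exists n (a b : 'I_n -> K),
     [/\ (forall i, I (a i)), (forall i, J (b i)) & x = \sum_i a i * b i]].

Fixpoint ideal_pow A I n : set K :=
  if n is n'.+1 then ideal_mul I (ideal_pow A I n') else A.

Definition localization A P : set K :=
  [set u | exists x y, [/\ A x, A y, ~ P y & u = x / y]].

(* The coordinate ring of the standard affine open D_+(z) (z of degree 1) of
   Proj (S + m + m^2 + ...), i.e. the degree-zero part of the localization of
   the Rees algebra at z; this is the ring usually written S[m/z]. *)
Definition blowup_chart S z : set K :=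
  [set u | exists n w, ideal_pow S 'm_S n w /\ u = w / z ^+ n].

(* The charts D_+(z), 0 != z in m, cover the blowing-up of Spec S at m.  The
   closed points of the exceptional fibre lying in D_+(z) are the maximal
   ideals of the chart that contain m. *)
Definition N1 S : set (set K) :=
  [set T | exists z P,
     [/\ 'm_S z, z != 0, is_maximal_ideal (blowup_chart S z) P,
         'm_S `<=` P & T = localization (blowup_chart S z) P]].

(* [S = s 0 < s 1 < ... < s n = T], each ring being a quadratic transform of
   its predecessor. *)
Definition quadratic_sequence S (T : set K) n (s : nat -> set K) : Prop :=
  [/\ s 0%N = S, s n = T
    & forall i, (i < n)%N -> s i `<` s i.+1 /\ N1 (s i) (s i.+1)].

Definition ord_eq S x n : Prop :=
  ideal_pow S 'm_S n x /\ ~ ideal_pow S 'm_S n.+1 x.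

Definition val_eq S u (k : int) : Prop :=
  exists x y p q,
    [/\ ord_eq S x p, ord_eq S y q, u = x / y & k = p%:Z - q%:Z].

Definition ord_valuation_ring S : set K :=
  [set u | u = 0 \/ exists2 k : int, 0 <= k & val_eq S u k].

(* [proximate S T] is S \prec T, i.e. T is proximate to S. *)
Definition proximate S (T : set K) : Prop :=
  S `<` T /\ T `<=` ord_valuation_ring S.

(* The residues of e 0, ..., e (n-1) form a basis of k_T over k_S. *)
Definition residue_basis S (T : set K) n (e : 'I_n -> K) : Prop :=
  [/\ (forall i, T (e i)),
      (forall t, T t -> exists2 a : 'I_n -> K,
         (forall i, S (a i)) & 'm_T (t - \sum_i a i * e i))
    & (forall a : 'I_n -> K, (forall i, S (a i)) ->
         'm_T (\sum_i a i * e i) -> forall i, 'm_S (a i))].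

(* [residue_degree S T] is [T : S] = [k_T : k_S], and 0 if k_T is not finite
   over k_S. *)
Definition residue_degree S (T : set K) : nat :=
  xget 0%N [set n | exists e : 'I_n -> K, residue_basis S T e].

Definition cluster (R : set K) (C : {fset set K}) : Prop :=
  [/\ (forall T, T \in C -> Omega R T), R \in C
    & forall T, T \in C -> exists n s, quadratic_sequence R T n s /\
        forall i, (i <= n)%N -> s i \in C].

Section Matrices.
Variables (R : set K) (C : {fset set K}).

(* Matrices with rows and columns indexed by C use the enumeration
   [enum_val] / [enum_rank] of the finType C. *)
Definition pt (i : 'I_#|{: C}|) : set K := fsval (enum_val i).

Definition proximity_matrix : 'M[int]_#|{: C}| :=
  \matrix_(i, j) (if pt i == pt j then 1
                  else if `[< proximate (pt i) (pt j) >] then -1 else 0).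

Definition degree_matrix : 'M[int]_#|{: C}| :=
  diag_mx (\row_i (residue_degree R (pt i))%:Z).

Definition intersection_matrix : 'M[int]_#|{: C}| :=
  - (proximity_matrix *m degree_matrix *m proximity_matrix^T).

(* The entry n_{S,T} of the intersection matrix. *)
Definition intersection_entry (S T : C) : int :=
  intersection_matrix (enum_rank S) (enum_rank T).

End Matrices.

(* T is proximate to S, and the unique T* in N_1(T) proximate to S is not in
   C. *)
Definition proximate_star_notin (C : {fset set K}) S (T : set K) : Prop :=
  proximate S T /\
  exists Tstar : set K,
    unique (fun U => N1 T U /\ proximate S U) Tstar /\ Tstar \notin C.

End LocalRings.

(* Main.v *)
(** The entry [n_{S,T}] is minus the sum over [U] in the cluster of
    [p_{S,U} * [U:R] * p_{T,U}], so everything depends on which [U] are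
    proximate to both [S] and [T].

    If [U] is proximate to [S], then [S <= U <= V_S] and [V_S] dominates [S], so
    [U] dominates [S]; as a local ring dominates at most one quadratic transform
    of a point that it dominates, [S] occurs in the quadratic sequence of [U].
    Hence two points to which [U] is proximate are comparable, and then one of
    them is proximate to the other.

    If [T] is proximate to [S], an induction along the quadratic sequence from
    [S] to [T] gives regular parameters [x, y] of [T] with [x] a nonunit and [y]
    a unit of [V_S] ("[x = 0] is the strict transform of the exceptional curve
    of [S]").  Then [T*] is the localization of [T[x/y]] at [(y, x/y)]: it has
    the residue field of [T], and its parameters [x/y, y] are adapted to [V_S]
    and, in the opposite order, to [V_T].  The strict transforms of two
    transversal curves are disjoint after one more blowing-up, so [T*] is the only
    point proximate to both [S] and [T].

    All of this rests on the fact that the associated graded ring of a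
    two-dimensional regular local ring is a polynomial ring in two variables over
    the residue field, which is derived from Krull's principal ideal theorem. *)

Require Import Defs.
From mathcomp Require Import all_boot all_order all_algebra.
From mathcomp Require Import finmap all_classical.
From mathcomp Require Import ring zify.

Set Implicit Arguments.
Unset Strict Implicit.
Unset Printing Implicit Defensive.

Import GRing.Theory.
Local Open Scope classical_set_scope.
Local Open Scope ring_scope.

Notation "''m_' S" := (nonunits S) (at level 8, S at level 2, format "''m_' S").

(** * Subrings, local rings and noetherian rings *)

Section Subrings.
Variable K : fieldType.
Implicit Types (A B I J : set K) (u v x y : K) (f g : {poly K}).

Definition subring A : Prop :=
  [/\ A 1, (forall x y, A x -> A y -> A (x - y))
    & (forall x y, A x -> A y -> A (x * y))].

Definition coefs_in I f : Prop := forall i, I f`_i.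

Lemma subring0 A : subring A -> A 0.
Proof. by case=> A1 AB _; rewrite -(subrr 1); apply: AB. Qed.

Lemma subringN A x : subring A -> A x -> A (- x).
Proof. by move=> hA Ax; rewrite -sub0r; case: (hA) => _ AB _; apply: AB => //;
  apply: subring0. Qed.

Lemma subringD A x y : subring A -> A x -> A y -> A (x + y).
Proof.
by move=> hA Ax Ay; rewrite -[y]opprK; case: (hA) => _ AB _; apply: AB => //;
  apply: subringN.
Qed.

Lemma subringM A x y : subring A -> A x -> A y -> A (x * y).
Proof. by case=> _ _; apply. Qed.

Lemma subringX A x n : subring A -> A x -> A (x ^+ n).
Proof.
move=> hA Ax; elim: n => [|n IHn]; first by rewrite expr0; case: hA.
by rewrite exprS; apply: subringM.
Qed.

Lemma subring_ideal A : subring A -> is_ideal A A.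
Proof.
move=> hA; split=> //; [exact: subring0 | move=> x y; exact: subringD | move=> x y;
  exact: subringM].
Qed.

Section Ideals.
Variables (A I : set K).
Hypotheses (hA : subring A) (hI : is_ideal A I).

Lemma ideal0 : I 0. Proof. by case: hI. Qed.
Lemma idealS u : I u -> A u. Proof. by case: hI => + _ _ _; apply. Qed.
Lemma idealD u v : I u -> I v -> I (u + v). Proof. by case: hI => _ _ + _; apply. Qed.
Lemma idealMl u v : A u -> I v -> I (u * v). Proof. by case: hI => _ _ _; apply. Qed.
Lemma idealMr u v : I u -> A v -> I (u * v).
Proof. by move=> Iu Av; rewrite mulrC; apply: idealMl. Qed.
Lemma idealN u : I u -> I (- u).
Proof.
move=> Iu; rewrite -mulN1r; apply: idealMl => //; apply: subringN => //.
by case: hA.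
Qed.
Lemma idealB u v : I u -> I v -> I (u - v).
Proof. by move=> Iu /idealN; apply: idealD. Qed.
Lemma ideal_sum (T : Type) (r : seq T) (P : pred T) (F : T -> K) :
  (forall i, P i -> I (F i)) -> I (\sum_(i <- r | P i) F i).
Proof. by move=> IF; elim/big_ind: _ => //; [exact: ideal0 | exact: idealD]. Qed.

Lemma coefs_inD f g : coefs_in I f -> coefs_in I g -> coefs_in I (f + g).
Proof. by move=> If Ig i; rewrite coefD; apply: idealD. Qed.
Lemma coefs_inN f : coefs_in I f -> coefs_in I (- f).
Proof. by move=> If i; rewrite coefN; apply: idealN. Qed.
Lemma coefs_inB f g : coefs_in I f -> coefs_in I g -> coefs_in I (f - g).
Proof. by move=> If /coefs_inN; apply: coefs_inD. Qed.
Lemma coefs_inM f g : coefs_in A f -> coefs_in I g -> coefs_in I (f * g).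
Proof. by move=> Af Ig i; rewrite coefM; apply: ideal_sum => j _; apply: idealMl. Qed.
Lemma coefs_inC u : I u -> coefs_in I u%:P.
Proof. by move=> Iu i; rewrite coefC; case: ifP => // _; exact: ideal0. Qed.
Lemma coefs_inZ u f : A u -> coefs_in I f -> coefs_in I (u *: f).
Proof. by move=> Au If i; rewrite coefZ; apply: idealMl. Qed.

Lemma horner_ideal f u : coefs_in I f -> A u -> I f.[u].
Proof.
move=> If Au; rewrite horner_coef; apply: ideal_sum => i _.
by apply: idealMr => //; apply: subringX.
Qed.

Lemma ideal_cancel u v : A u -> A u^-1 -> u != 0 -> I (u * v) -> I v.
Proof. by move=> Au Au' u0 Iuv; rewrite -(mulKf u0 v); apply: idealMl. Qed.

End Ideals.

Lemma coefs_in1 A : subring A -> coefs_in A 1%:P.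
Proof. by move=> hA; apply: coefs_inC (subring_ideal hA) _ _; case: hA. Qed.

Lemma coefs_inX A : subring A -> coefs_in A 'X.
Proof.
move=> hA i; rewrite coefX; case: eqP => _ /=; last exact: subring0.
by case: hA.
Qed.

Lemma coefs_in_sub I J f : I `<=` J -> coefs_in I f -> coefs_in J f.
Proof. by move=> IJ If i; apply: IJ. Qed.

End Subrings.

Section LocalRings.
Variables (K : fieldType) (A : set K).
Hypothesis hA : local_ring A.
Implicit Types u v : K.

Lemma local_subring : subring A.
Proof.
case: hA => -[h1 h2 h3] _; split.
- by move: h1; rewrite inE.
- by move=> x y Ax Ay; have := h2 x y; rewrite !inE; apply.
- by move=> x y Ax Ay; have := h3 x y; rewrite !inE; apply.
Qed.

Lemma nonunits_ideal : is_ideal A 'm_A. Proof. by case: hA. Qed.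

Lemma nonunits1 : ~ 'm_A 1.
Proof. by case=> A1; apply; exists 1; rewrite ?mulr1. Qed.

Lemma unit_inv u : A u -> ~ 'm_A u -> u != 0 /\ A u^-1.
Proof.
move=> Au nmu; have [y Ay uy1] : exists2 y, A y & u * y = 1.
  by apply: contrapT => h; apply: nmu.
have u0 : u != 0 by apply/eqP => u0; move: uy1; rewrite u0 mul0r => /esym/eqP;
  rewrite oner_eq0.
by split=> //; rewrite (_ : u^-1 = y) // -[RHS](mulKf u0) uy1 mulr1.
Qed.

Lemma inv_notin_nonunits u : 'm_A u -> u != 0 -> ~ A u^-1.
Proof. by case=> _ h u0 Au; apply: h; exists u^-1 => //; rewrite mulfV. Qed.

Lemma unit_1B u : 'm_A u -> ~ 'm_A (1 - u).
Proof.
move=> mu m1u; apply: nonunits1; rewrite -(subrK u 1).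
exact: (idealD nonunits_ideal).
Qed.

Lemma nonunits_prime u v : A u -> A v -> 'm_A (u * v) -> 'm_A u \/ 'm_A v.
Proof.
move=> Au Av muv; apply: contrapT => /not_orP[nu nv].
have [u0 Au'] := unit_inv Au nu.
by apply: nv; apply: (ideal_cancel nonunits_ideal Au Au' u0 muv).
Qed.

End LocalRings.

(** * Nakayama's lemma and Krull's intersection theorem for principal ideals *)

Section Noetherian.
Variables (K : fieldType) (A : set K).
Hypotheses (hA : local_ring A) (hN : noetherian A).
Let sA : subring A := local_subring hA.
Let mI : is_ideal A 'm_A := nonunits_ideal hA.

(** The chain condition for the ideals [L n], which are [I + (a 0, ..., a (n-1))]: their union is
    finitely generated, and the generators already lie in one [L N]. *)
Lemma noetherian_seq (I : set K) (a : nat -> K) :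
  is_ideal A I -> (forall i, A (a i)) ->
  exists k (c : nat -> K), (forall i, A (c i)) /\ I (a k - \sum_(i < k) c i * a i).
Proof.
move=> hI Aa.
pose L n : set K := [set u | A u /\ exists2 c : nat -> K, (forall i, A (c i)) & I (u - \sum_(i < n) c i * a i)].
have LS n u : L n u -> L n.+1 u.
  case=> Au [c Ac Iu]; split=> //; exists (fun i => if (i < n)%N then c i else 0).
    by move=> i; case: ifP => // _; exact: subring0.
  rewrite big_ord_recr /= ltnn mul0r addr0.
  by under eq_bigr => i _ do rewrite ltn_ord.
have Lle n m u : (n <= m)%N -> L n u -> L m u.
  by move=> /subnK <-; elim: (m - n)%N => // d IHd /IHd /LS.
have LI n : is_ideal A (L n).
  split.
  - by move=> u [].
  - split; first exact: subring0; exists (fun=> 0) => [_|]; first exact: subring0.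
    under eq_bigr => i _ do rewrite mul0r.
    by rewrite big1 // subrr; exact: ideal0 hI.
  - move=> u v [Au [c Ac Iu]] [Av [d Ad Iv]]; split; first exact: subringD.
    exists (fun i => c i + d i) => [i|]; first exact: subringD.
    under eq_bigr => i _ do rewrite mulrDl.
    by rewrite big_split /= opprD addrACA; apply: (idealD hI).
  - move=> u v Au [Av [d Ad Iv]]; split; first exact: subringM.
    exists (fun i => u * d i) => [i|]; first exact: subringM.
    under eq_bigr => i _ do rewrite -mulrA.
    by rewrite -mulr_sumr -mulrBr; apply: (idealMl hI).
have LUI : is_ideal A [set u | exists n, L n u].
  split.
  - by move=> u [n []].
  - by exists 0%N; exact: (ideal0 (LI 0%N)).
  - move=> u v [n Lu] [m Lv]; exists (maxn n m).
    by apply: (idealD (LI _)); [apply: Lle Lu; exact: leq_maxl | apply: Lle Lv;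
      exact: leq_maxr].
  - by move=> u v Au [n Lv]; exists n; apply: (idealMl (LI n)).
have [m [g Lg]] := hN LUI.
have gL j : exists n, L n (g j).
  rewrite -/([set u | exists n, L n u] (g j)) Lg; exists (fun i => (i == j)%:R).
    by move=> i; case: eqP => _; [case: sA | exact: subring0].
  rewrite (bigD1 j) //= eqxx mul1r big1 ?addr0 // => i /negbTE ->.
  by rewrite mul0r.
have [n Ln] := fin_all_exists gL.
pose N := (\max_j n j)%N.
have /(_ (a N)) LN u : (exists n, L n u) -> L N u.
  rewrite -/([set u | exists n, L n u] u) Lg => -[d Ad ->].
  apply: (ideal_sum (LI N)) => j _; apply: (idealMl (LI N)) => //.
  by apply: Lle (Ln j); exact: leq_bigmax.
have [|_ [c Ac Ic]] := LN; last by exists N, c.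
exists N.+1; split=> //; exists (fun i => (i == N)%:R).
  by move=> i; case: eqP => _; [case: sA | exact: subring0].
rewrite big_ord_recr /= eqxx mul1r big1 ?add0r ?subrr; first exact: ideal0 hI.
by move=> i _; rewrite ltn_eqF ?mul0r.
Qed.

Let sum_nonunits (x : K) k (c : nat -> K) : 'm_A x -> (forall i, A (c i)) ->
  'm_A (\sum_(i < k) c i * x ^+ (k - i)).
Proof.
move=> mx Ac; apply: (ideal_sum mI) => i _; apply: (idealMl mI) => //.
rewrite -(subnSK (ltn_ord i)) exprS; apply: (idealMr mI) => //.
exact: subringX (idealS mI _).
Qed.

Let unit_1B_cancel (I : set K) s u : is_ideal A I -> 'm_A s -> I ((1 - s) * u) -> I u.
Proof.
move=> hI ms; have As := idealS mI ms.
have A1 : A (1 - s) by case: (sA) => h1 h2 _; apply: h2.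
have [s0 As'] := unit_inv A1 (unit_1B hA ms).
exact: (ideal_cancel hI A1 As' s0).
Qed.

(** Iterating the hypothesis gives a sequence in [J] with [a 0 = u] and [a i] congruent to
    [y * a i.+1] modulo [I]. Some [a k] is a combination of earlier terms, each congruent to
    [y ^+ (k - i) * a k]; so a unit [1 - s] sends [a k] into [I], and [u] is congruent to
    [y ^+ k * a k]. *)
Lemma principal_nakayama (I J : set K) (y : K) : is_ideal A I -> 'm_A y ->
  J `<=` A -> (forall u, J u -> exists v, J v /\ I (u - y * v)) -> J `<=` I.
Proof.
move=> hI my JA hJ u Ju.
have /choice[F hF] : forall u, exists v, J u -> J v /\ I (u - y * v).
  by move=> v; have [Jv|nJv] := pselect (J v); [have [w] := hJ v Jv; exists w | exists 0].
pose a i := iter i F u.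
have Ja i : J (a i) by elim: i => //= i IHi; have [] := hF _ IHi.
have aS i : I (a i - y * a i.+1) by have [] := hF _ (Ja i).
have Ay := idealS mI my.
have aD i d : I (a i - y ^+ d * a (d + i)%N).
  elim: d => [|d IHd]; first by rewrite expr0 mul1r subrr; exact: ideal0 hI.
  have -> : a i - y ^+ d.+1 * a (d.+1 + i)%N =
    (a i - y ^+ d * a (d + i)%N) + y ^+ d * (a (d + i)%N - y * a (d + i).+1).
    by rewrite addSn exprS; ring.
  by apply: (idealD hI) => //; apply: (idealMl hI) => //; apply: subringX.
have [k [c [Ac Ik]]] := noetherian_seq hI (fun i => JA _ (Ja i)).
have : I (a k).
  apply: (unit_1B_cancel hI (sum_nonunits k my Ac)).
  have -> : (1 - \sum_(i < k) c i * y ^+ (k - i)) * a k =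
    (a k - \sum_(i < k) c i * a i) + \sum_(i < k) c i * (a i - y ^+ (k - i) * a k).
    under [X in _ = _ + X]eq_bigr => i _ do rewrite mulrBr mulrA.
    by rewrite sumrB -mulr_suml; ring.
  apply: (idealD hI) => //; apply: (ideal_sum hI) => i _; apply: (idealMl hI) => //.
  by have := aD i (k - i)%N; rewrite subnK // ltnW.
move=> Iak; have := aD 0%N k;
  rewrite addn0 => /(idealD hI) /(_ (idealMl hI (subringX k sA Ay) Iak)).
by rewrite subrK.
Qed.

(** The chain condition is applied to the cofactors [a i]: a relation of [a k] with the earlier
    ones, multiplied by [x ^+ k], becomes [g = s * g] modulo [I] with [s] in the maximal ideal. *)
Lemma principal_krull (I : set K) (x g : K) : is_ideal A I -> 'm_A x -> A g ->
  (forall i, exists a, A a /\ I (g - x ^+ i * a)) -> I g.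
Proof.
move=> hI mx Ag /choice[a ha].
have Ax := idealS mI mx.
have [k [c [Ac Ik]]] := noetherian_seq hI (fun i => (ha i).1).
apply: (unit_1B_cancel hI (sum_nonunits k mx Ac)).
have -> : (1 - \sum_(i < k) c i * x ^+ (k - i)) * g =
  (g - x ^+ k * a k) + x ^+ k * (a k - \sum_(i < k) c i * a i)
    - \sum_(i < k) c i * x ^+ (k - i) * (g - x ^+ i * a i).
  rewrite [\sum_(i < k) c i * x ^+ (k - i) * (g - _)](_ : _ =
     (\sum_(i < k) c i * x ^+ (k - i)) * g - x ^+ k * \sum_(i < k) c i * a i).
    by ring.
  rewrite mulr_suml mulr_sumr -sumrB; apply: eq_bigr => i _.
  by rewrite -[in x ^+ k](subnK (ltnW (ltn_ord i))) exprD; ring.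
apply: (idealB sA hI).
  apply: (idealD hI); first by case: (ha k).
  by apply: (idealMl hI) => //; apply: subringX.
apply: (ideal_sum hI) => i _; apply: (idealMl hI); last by case: (ha i).
by apply: subringM => //; apply: subringX.
Qed.

End Noetherian.

(** * Two-dimensional regular local rings *)

Definition params (K : fieldType) (A : set K) (x y : K) : Prop :=
  [/\ 'm_A x, 'm_A y
    & forall u, 'm_A u -> exists a b, [/\ A a, A b & u = a * x + b * y]].

Lemma params_sym (K : fieldType) (A : set K) (x y : K) : params A x y -> params A y x.
Proof.
case=> mx my hm; split=> // u /hm[a [b [Aa Ab ->]]]; exists b, a; split=> //.
exact: addrC.
Qed.

Definition principal (K : fieldType) (A : set K) (y : K) : set K :=
  [set u | exists2 a, A a & u = y * a].

Lemma regular_params (K : fieldType) (A : set K) :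
  regular_local_ring 2 A -> exists x y, params A x y.
Proof.
case=> hA _ _ [g hg]; have sA := local_subring hA.
exists (g ord0), (g ord_max).
have gm i : 'm_A (g i).
  rewrite hg; exists (fun j => (j == i)%:R).
    by move=> j; case: eqP => _; [case: sA | exact: subring0].
  rewrite (bigD1 i) //= eqxx mul1r big1 ?addr0 // => j /negbTE ->.
  by rewrite mul0r.
split=> // u; rewrite hg => -[a Aa ->]; exists (a ord0), (a ord_max); split=> //.
rewrite big_ord_recr big_ord_recr big_ord0 /= add0r.
by congr (_ * _ + _); congr (_ _); apply/val_inj.
Qed.

(** * Krull's principal ideal theorem in the presence of two parameters *)

Section PrincipalIdealTheorem.
Variables (K : fieldType) (A : set K).
Hypotheses (hA : local_ring A) (hN : noetherian A).
Let sA : subring A := local_subring hA.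
Let mI : is_ideal A 'm_A := nonunits_ideal hA.

Lemma principal_ideal y : A y -> is_ideal A (principal A y).
Proof.
move=> Ay; split.
- by move=> _ [a Aa ->]; apply: subringM.
- by exists 0; rewrite ?mulr0 //; exact: subring0.
- by move=> _ _ [a Aa ->] [b Ab ->]; exists (a + b); rewrite ?mulrDr //; apply: subringD.
- by move=> u _ Au [b Ab ->]; exists (u * b); rewrite 1?mulrCA //; apply: subringM.
Qed.

Lemma prime_pow P u n : is_prime_ideal A P -> A u -> P (u ^+ n) -> P u.
Proof.
case=> _ P1 hP Au; elim: n => [|n IHn]; first by rewrite expr0.
by rewrite exprS => /hP[] //; apply: subringX.
Qed.

(** Modulo [y] the maximal ideal is generated by [x]: as long as the coefficient is a nonunit,
    another factor [x] splits off. *)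
Lemma params_expansion x y N g : params A x y -> A g ->
  (exists j u h, [/\ (j < N)%N, A u, ~ 'm_A u, A h & g = u * x ^+ j + y * h]) \/
  (exists c h, [/\ A c, A h & g = c * x ^+ N + y * h]).
Proof.
move=> [mx my hm] Ag.
have [Ax Ay] := (idealS mI mx, idealS mI my).
elim: N => [|N [[j [u [h [jN Au nu Ah ->]]]]|[c [h [Ac Ah ->]]]]].
- by right; exists g, 0; split=> //; [exact: subring0 | rewrite expr0; ring].
- by left; exists j, u, h; split=> //; apply: leqW.
have [mc|nc] := pselect ('m_A c); last by left; exists N, c, h; split.
have [a [b [Aa Ab ->]]] := hm c mc; right; exists a, (h + b * x ^+ N); split=> //.
  by apply: subringD => //; apply: subringM => //; apply: subringX.
by rewrite exprS; ring.
Qed.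

(* The decreasing ideals [I_n = f^n A_p `&` A] become stationary modulo [y],
   since [m / yA] is principal and nilpotent; by Nakayama they are stationary,
   and then [f] is a unit of [A_p]. *)
Lemma principal_ideal_theorem P x y n : params A x y -> is_prime_ideal A P ->
  (exists2 f, P f & f != 0) -> (exists2 w, 'm_A w & ~ P w) ->
  ~ principal A y (x ^+ n).
Proof.
move=> hxy hP [f Pf f0] [w mw nPw] [e Ae xne].
have [[PI P1 Pprime] [mx my hm]] := (hP, hxy).
have [Ax Ay Af] : [/\ A x, A y & A f].
  by split; [exact: (idealS mI) | exact: (idealS mI) | exact: (idealS PI)].
have A1 : A 1 by case: sA.
have nPy : ~ P y.
  move=> Py; have Px : P x.
    by apply: (prime_pow (n := n) hP Ax); rewrite xne; apply: (idealMr PI).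
  apply: nPw; have [a [b [Aa Ab ->]]] := hm w mw.
  by apply: (idealD PI); apply: (idealMl PI).
pose I k : set K := [set a | A a /\ exists s b, [/\ A s, ~ P s, A b & s * a = f ^+ k * b]].
have nPM s t : A s -> A t -> ~ P s -> ~ P t -> ~ P (s * t).
  by move=> As At ns nt /Pprime[].
have II k : is_ideal A (I k).
  split.
  - by move=> u [].
  - split; first exact: subring0.
    by exists 1, 0; split=> //; [exact: subring0 | rewrite !mulr0].
  - move=> u v [Au [s [b [As Ps Ab sb]]]] [Av [t [c [At Pt Ac tc]]]].
    split; first exact: subringD.
    exists (s * t), (t * b + s * c); split.
    + exact: subringM.
    + exact: nPM.
    + by apply: subringD => //; apply: subringM.
    + have -> : s * t * (u + v) = t * (s * u) + s * (t * v) by ring.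
      by rewrite sb tc; ring.
  - move=> u v Au [Av [s [b [As Ps Ab sb]]]]; split; first exact: subringM.
    exists s, (u * b); split=> //; first exact: subringM.
    have -> : s * (u * v) = u * (s * v) by ring.
    by rewrite sb; ring.
have IS k : I k.+1 `<=` I k.
  move=> u [Au [s [b [As Ps Ab sb]]]]; split=> //; exists s, (f * b); split=> //.
    exact: subringM.
  by rewrite sb exprSr mulrA.
(* [J k] is [I k + yA]. Since [x ^+ n] is in [yA], every element is modulo [y] zero or a unit times
   some [x ^+ i] with [i < n]; so it suffices that membership of these finitely many powers
   stabilizes. *)
pose J k : set K := [set u | exists v h, [/\ I k v, A h & u = v + y * h]].
have Jle k l : (k <= l)%N -> J l `<=` J k.
  move=> /subnK <-; elim: (l - k)%N => // d IHd u [v [h [Iv Ah ->]]]; apply: IHd.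
  by exists v, h; split=> //; apply: IS.
have /fin_all_exists[k0 hk0] : forall i : 'I_n, exists k0, forall k,
    (k0 <= k)%N -> J k (x ^+ i) -> J k.+1 (x ^+ i).
  move=> i; have [h|/existsNP[k nJ]] := pselect (forall k, J k (x ^+ i)).
    by exists 0%N.
  by exists k => l kl /(Jle _ _ kl).
pose k := (\max_i k0 i)%N.
have Jk (i : 'I_n) : J k (x ^+ i) -> J k.+1 (x ^+ i) by apply: hk0; exact: leq_bigmax.
have IJ : I k `<=` J k.+1.
  move=> g Ig;
    have [[j [u [h [jn Au nu Ah gE]]]]|[c [h [Ac Ah gE]]]] := params_expansion n hxy (idealS (II k) Ig); last first.
    exists 0, (c * e + h); split.
    - exact: (ideal0 (II _)).
    - by apply: subringD => //; apply: subringM.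
    - by rewrite gE xne; ring.
  have [u0 Au'] := unit_inv Au nu.
  have /(Jk (Ordinal jn)) [v [h' [Iv Ah' /= xj]]] : J k (x ^+ Ordinal jn).
    exists (u^-1 * g), (- (u^-1 * h)); split.
    - by apply: (idealMl (II k)).
    - by apply: subringN => //; apply: subringM.
    - by rewrite gE /=; field.
  exists (u * v), (u * h' + h); split.
  - exact: (idealMl (II _)).
  - by apply: subringD => //; apply: subringM.
  - by rewrite gE xj; ring.
(* If [g = v + y * h] with [g] in [I k] and [v] in [I k.+1], then [y * h] is in [I k], and so is [h]
   because [y] is outside [P]; thus Nakayama applies. *)
have /(_ (f ^+ k)) Ifk : I k `<=` I k.+1.
  apply: (principal_nakayama hA hN (II _) my); first exact: (idealS (II k)).
  move=> g Ig; have [v [h [Iv Ah gE]]] := IJ g Ig.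
  exists h; split; last by rewrite gE addrK.
  have [_ [s [b [As Ps Ab sb]]]] : I k (y * h).
    have -> : y * h = g - v by rewrite gE; ring.
    by apply: (idealB sA (II k)) => //; apply: IS.
  split=> //; exists (s * y), b; split=> //; first exact: subringM.
    exact: nPM.
  by rewrite -mulrA.
(* Cancelling [f ^+ k] shows that some [s] outside [P] is a multiple of [f]. *)
have [|_ [s [b [As Ps Ab]]]] := Ifk.
  by split; [exact: subringX | exists 1, 1; split; rewrite ?mul1r ?mulr1].
rewrite exprSr -mulrA mulrC => /(mulfI (expf_neq0 k f0)) sE.
by apply: Ps; rewrite sE; apply: (idealMr PI).
Qed.

End PrincipalIdealTheorem.

(** Gauss's argument: for the lowest coefficients of [f] and [g] outside the maximal ideal, in
    degrees [i] and [j], all other terms of the coefficient of [f * g] in degree [i + j] lie in that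
    ideal. *)
Lemma coefM_prime (K : fieldType) (A : set K) (f g : {poly K}) :
  local_ring A -> coefs_in A f -> coefs_in A g -> coefs_in 'm_A (f * g) ->
  coefs_in 'm_A f \/ coefs_in 'm_A g.
Proof.
move=> hA Af Ag mfg; have mI := nonunits_ideal hA.
apply: contrapT => /not_orP[/existsNP nf /existsNP ng].
have least (h : {poly K}) : (exists i, ~ 'm_A h`_i) ->
    exists i, ~ 'm_A h`_i /\ forall j, (j < i)%N -> 'm_A h`_j.
  move=> [i hi]; have ex : exists i, ~~ `[< 'm_A h`_i >] by exists i; apply/asboolPn.
  case: (ex_minnP ex) => j /asboolPn nj jmin; exists j; split=> // l lj.
  by apply: contrapT => /asboolPn /jmin; rewrite leqNgt lj.
have [i [ni mi]] := least f nf; have [j [nj mj]] := least g ng.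
have ij : (i < (i + j).+1)%N by rewrite ltnS leq_addr.
have := mfg (i + j)%N; rewrite coefM (bigD1 (Ordinal ij)) //= addKn => mS.
suff /(nonunits_prime hA (Af i) (Ag j))[] : 'm_A (f`_i * g`_j) by [].
move: mS; set s := (X in _ + X) => mS; rewrite -[_ * _](addrK s).
apply: (idealB (local_subring hA) mI mS); apply: (ideal_sum mI) => k /eqP ki.
case: (ltngtP k i) => [lt_ki|lt_ik|eq_ki].
- by apply: (idealMr mI) => //; apply: mi.
- by apply: (idealMl mI) => //; apply: mj; have := ltn_ord k; lia.
- by case: ki; apply: val_inj.
Qed.

(** * The associated graded ring and the order function *)

Section RegularLocalRings.
Variables (K : fieldType) (A : set K).
Hypothesis hR : regular_local_ring 2 A.

Lemma regular_local : local_ring A. Proof. by case: hR. Qed.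
Let hA : local_ring A := regular_local.
Let sA : subring A := local_subring hA.
Let mI : is_ideal A 'm_A := nonunits_ideal hA.

(** Dimension two enters here: the middle prime of a chain of length two is nonzero and does not
    contain the maximal ideal, so the principal ideal theorem applies to it. *)
Lemma regular_pow_notin x y n : params A x y -> ~ principal A y (x ^+ n).
Proof.
move=> hxy; have [_ hN [[p [hp hlt]] _] _] := hR.
have [p01 p12] := (hlt 0%N isT, hlt 1%N isT).
have [[P0I _ _] [P2I P21 _]] := (hp 0%N isT, hp 2%N isT).
apply: (principal_ideal_theorem hA hN hxy (hp 1%N isT)).
  case: p01 => _ /existsNP[f /not_implyP[Pf nPf]]; exists f => //.
  by apply/eqP => f0; apply: nPf; rewrite f0; exact: (ideal0 P0I).
case: p12 => _ /existsNP[w /not_implyP[Pw nPw]]; exists w => //.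
have Aw := idealS P2I Pw.
apply: contrapT => nw; have [w0 Aw'] := unit_inv Aw nw.
by apply: P21; rewrite -(mulVf w0); apply: (idealMl P2I).
Qed.

Lemma params_neq0 x y : params A x y -> y != 0.
Proof.
move=> /params_sym hyx; apply/eqP => y0.
apply: (regular_pow_notin (n := 1) hyx); exists 0; first exact: subring0.
by rewrite y0 mulr0.
Qed.

(** The quotient by [y] is a discrete valuation ring with uniformizer [x]: outside [yA], by Krull's
    intersection theorem, every element is modulo [y] a unit times a power of [x], and no such power
    is in [yA]. *)
Lemma principal_prime x y a b : params A x y -> A a -> A b ->
  principal A y (a * b) -> principal A y a \/ principal A y b.
Proof.
move=> hxy Aa Ab yab; apply: contrapT => /not_orP[na nb].
have [mx my _] := hxy; have [Ax Ay] := (idealS mI mx, idealS mI my).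
have yI := principal_ideal hA Ay.
have lead g : A g -> ~ principal A y g ->
    exists j u h, [/\ A u, ~ 'm_A u, A h & g = u * x ^+ j + y * h].
  move=> Ag ng; apply: contrapT => nex; apply: ng.
  have hN : noetherian A by case: hR.
  apply: (principal_krull hA hN yI mx Ag) => i.
  have [[j [u [h [_ Au nu Ah gE]]]]|[c [h [Ac Ah ->]]]] := params_expansion hA i hxy Ag.
    by case: nex; exists j, u, h.
  by exists c; split=> //; exists h => //; ring.
have [i [u [h [Au nu Ah aE]]]] := lead a Aa na.
have [j [v [k [Av nv Ak bE]]]] := lead b Ab nb.
have [u0 Au'] := unit_inv Au nu; have [v0 Av'] := unit_inv Av nv.
apply: (regular_pow_notin (n := (i + j)%N) hxy).
apply: (ideal_cancel yI Au Au' u0); apply: (ideal_cancel yI Av Av' v0).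
have -> : v * (u * x ^+ (i + j)) = a * b - y * (h * b + u * x ^+ i * k).
  by rewrite aE bE exprD; ring.
apply: (idealB sA yI) => //; eexists; last by [].
apply: (subringD sA); apply: (subringM sA) => //.
by apply: (subringM sA) => //; apply: subringX.
Qed.

Lemma poly_drop1 (R : nzRingType) (f : {poly R}) : f = drop_poly 1 f * 'X + (f`_0)%:P.
Proof.
apply/polyP => -[|i]; rewrite coefD coefMX coefC /= ?add0r // addr0.
by rewrite coef_drop_poly addn1.
Qed.

Lemma coefs_in_drop (I : set K) n f : coefs_in I f -> coefs_in I (drop_poly n f).
Proof. by move=> If i; rewrite coef_drop_poly. Qed.

Lemma horner_drop1 (f : {poly K}) t : f.[t] = (drop_poly 1 f).[t] * t + f`_0.
Proof. by rewrite {1}[f]poly_drop1 !hornerE. Qed.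

Lemma size_drop1 (f : {poly K}) n : (size f <= n.+1)%N -> (size (drop_poly 1 f) <= n)%N.
Proof. by rewrite size_drop_poly => h; rewrite leq_subLR add1n. Qed.

(* A form of degree [n] in [x, y] is written [y ^+ n * f.[x / y]]. *)
Lemma form_in x y n f : A x -> A y -> y != 0 -> coefs_in A f ->
  (size f <= n.+1)%N -> A (y ^+ n * f.[x / y]).
Proof.
move=> Ax Ay y0; elim: n f => [|n IHn] f Af sf.
  by rewrite (size1_polyC sf) hornerC expr0 mul1r.
rewrite horner_drop1.
have -> : y ^+ n.+1 * ((drop_poly 1 f).[x / y] * (x / y) + f`_0) =
  (y ^+ n * (drop_poly 1 f).[x / y]) * x + y ^+ n.+1 * f`_0 by rewrite exprS; field.
apply: (subringD sA); apply: (subringM sA) => //; last exact: subringX.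
by apply: IHn; [apply: coefs_in_drop | apply: size_drop1].
Qed.

(** Induction on the size. A power of [y] times the constant coefficient is divisible by [x], so
    this coefficient is [x * d] by [principal_prime]. As [x = (x / y) * y], dividing the relation by
    [x / y] leaves the shorter one for [drop_poly 1 f + (y * d)%:P]. *)
Lemma params_independent x y f : params A x y -> coefs_in A f ->
  f.[x / y] = 0 -> coefs_in 'm_A f.
Proof.
move=> hxy; have hyx := params_sym hxy.
have [mx my _] := hxy; have [Ax Ay] := (idealS mI mx, idealS mI my).
have [y0 x0] := (params_neq0 hxy, params_neq0 hyx).
have t0 : x / y != 0 by rewrite mulf_neq0 ?invr_eq0.
move: {2}(size f) (leqnn (size f)) => n; elim: n f => [|n IHn] f sf Af ft0.
  by move: sf; rewrite leqn0 size_poly_eq0 => /eqP -> i; rewrite coef0; exact: (ideal0 mI).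
set f' := drop_poly 1 f; have Af' : coefs_in A f' by apply: coefs_in_drop.
have sf' : (size f' <= n)%N by apply: size_drop1.
have ft : f'.[x / y] * (x / y) + f`_0 = 0 by rewrite -horner_drop1.
have [d Ad cE] : principal A x f`_0.
  have : principal A x (f`_0 * y ^+ n).
    case: n sf sf' {IHn} => [|n] sf sf'.
      have f'0 : f' = 0 by apply/eqP; rewrite -size_poly_eq0 -leqn0.
      exists 0; first exact: subring0.
      by move: ft; rewrite f'0 horner0 mul0r add0r => ->; ring.
    exists (- (y ^+ n * f'.[x / y])).
      by apply: (subringN sA); apply: form_in.
    by rewrite -[f`_0](addKr (f'.[x / y] * (x / y))) ft exprS; field.
  case/(principal_prime hyx (Af 0%N) (subringX n sA Ay)) => //.
  by move/(regular_pow_notin hyx).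
have : coefs_in 'm_A (f' + (y * d)%:P).
  apply: IHn.
  - rewrite (leq_trans (size_polyD _ _)) // geq_max sf' /=.
    case: n sf sf' => [|n] sf sf'; last by rewrite (leq_trans (size_polyC_leq1 _)).
    have f'0 : f' = 0 by apply/eqP; rewrite -size_poly_eq0 -leqn0.
    move: ft; rewrite f'0 horner0 mul0r add0r cE => /eqP.
    by rewrite mulf_eq0 (negbTE x0) /= => /eqP ->; rewrite mulr0 size_poly0.
  - apply: (coefs_inD (subring_ideal sA)) => //.
    by apply: (coefs_inC (subring_ideal sA)); apply: subringM.
  - apply: (mulfI t0); rewrite mulr0 hornerD hornerC -[RHS]ft cE.
    by field.
have myd : coefs_in 'm_A (y * d)%:P := coefs_inC mI (idealMr mI my Ad).
move=> /(coefs_inB sA mI) /(_ myd); rewrite addrK => mf' [|i].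
  by rewrite cE; apply: (idealMr mI).
by have := mf' i; rewrite /f' coef_drop_poly addn1.
Qed.

Local Notation mpow := (ideal_pow A 'm_A).

Lemma ideal_powP x y n u : params A x y ->
  mpow n u <-> exists f, [/\ coefs_in A f, (size f <= n.+1)%N & u = y ^+ n * f.[x / y]].
Proof.
move=> hxy; have y0 := params_neq0 hxy.
have [mx my hm] := hxy; have [Ax Ay] := (idealS mI mx, idealS mI my).
have AI := subring_ideal sA.
elim: n u => [|n IHn] u; split.
- move=> /= Au; exists u%:P; split; [exact: (coefs_inC AI) | exact: size_polyC_leq1 |].
  by rewrite hornerC expr0 mul1r.
- by move=> [f [Af sf ->]]; exact: form_in.
- move=> [k [a [b [ma hb ->]]]].
  have /fin_all_exists[ab hab] : forall i, exists p : K * K, [/\ A p.1, A p.2 & a i = p.1 * x + p.2 * y].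
    by move=> i; have [c [d [Ac Ad ->]]] := hm _ (ma i); exists (c, d).
  have /fin_all_exists[F hF] : forall i, exists f, [/\ coefs_in A f, (size f <= n.+1)%N & b i = y ^+ n * f.[x / y]].
    by move=> i; apply/IHn; apply: hb.
  exists (\sum_i ((ab i).1 *: 'X + (ab i).2%:P) * F i); split.
  + move=> j; rewrite coef_sum; apply: (ideal_sum AI) => i _; apply: (coefs_inM AI).
      have [A1 A2 _] := hab i; apply: (coefs_inD AI); last exact: (coefs_inC AI).
      by apply: (coefs_inZ AI) => //; exact: coefs_inX.
    by case: (hF i).
  + apply: (leq_trans (size_sum _ _ _)); apply/bigmax_leqP => i _.
    apply: (leq_trans (size_polyMleq _ _)); have [_ sF _] := hF i.
    have : (size ((ab i).1 *: 'X + (ab i).2%:P)%R <= 2)%N.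
      rewrite (leq_trans (size_polyD _ _)) // geq_max (leq_trans (size_scale_leq _ _)) ?size_polyX //.
      by rewrite (leq_trans (size_polyC_leq1 _)).
    by move: sF; lia.
  + rewrite horner_sum mulr_sumr; apply: eq_bigr => i _.
    have [_ _ ->] := hab i; have [_ _ ->] := hF i.
    by rewrite hornerM hornerD hornerZ hornerX hornerC exprS; field.
- move=> [f [Af sf ->]].
  (* The form of degree [n.+1] is split into [x] times a form of degree [n] and [y] times the
     monomial carrying the constant coefficient of [f]. *)
  exists 2%N, (fun i => if i == 0%N :> nat then x else y),
    (fun i => if i == 0%N :> nat then y ^+ n * (drop_poly 1 f).[x / y] else y ^+ n * f`_0).
  split.
  + by move=> i; case: eqP.
  + move=> i; apply/IHn; case: eqP => _.
      by exists (drop_poly 1 f); split=> //; [apply: coefs_in_drop | apply: size_drop1].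
    exists (f`_0)%:P; split; [exact: (coefs_inC AI) | | by rewrite hornerC].
    by rewrite (leq_trans (size_polyC_leq1 _)).
  + by rewrite !big_ord_recl big_ord0 /= horner_drop1 exprS; field.
Qed.

(** This is the description of the graded ring as a polynomial ring over the residue field. If the
    form is also [y ^+ n.+1 * g.[x / y]], then [f - y *: g] vanishes at [x / y]. Conversely,
    coefficients in the maximal ideal give [f = x *: F + y *: G], which raises the degree by one. *)
Lemma form_pow_succ x y n f : params A x y -> coefs_in A f -> (size f <= n.+1)%N ->
  mpow n.+1 (y ^+ n * f.[x / y]) <-> coefs_in 'm_A f.
Proof.
move=> hxy Af sf; have y0 := params_neq0 hxy.
have [mx my hm] := hxy; have [Ax Ay] := (idealS mI mx, idealS mI my).
have AI := subring_ideal sA.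
rewrite (ideal_powP _ _ hxy); split=> [[g [Ag sg fg]]|mf].
  have myg : coefs_in 'm_A (y *: g).
    by move=> i; rewrite coefZ; apply: (idealMr mI).
  rewrite -[f](subrK (y *: g)); apply: (coefs_inD mI) => //.
  apply: (params_independent hxy).
    by apply: (coefs_inB sA AI) => //; apply: (coefs_inZ AI).
  apply: (mulfI (expf_neq0 n y0)); rewrite mulr0 hornerD hornerN hornerZ mulrBr fg.
  by rewrite exprSr; ring.
have /choice[ab hab] : forall i, exists p : K * K, [/\ A p.1, A p.2 & f`_i = p.1 * x + p.2 * y].
  by move=> i; have [c [d [Ac Ad ->]]] := hm _ (mf i); exists (c, d).
pose F := \poly_(i < n.+1) (ab i).1; pose G := \poly_(i < n.+1) (ab i).2.
have AF : coefs_in A F.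
  by move=> i; rewrite coef_poly; case: ifP => _; [case: (hab i) | exact: subring0].
have AG : coefs_in A G.
  by move=> i; rewrite coef_poly; case: ifP => _; [case: (hab i) | exact: subring0].
exists (F * 'X + G); split.
- apply: (coefs_inD AI) => //; apply: (coefs_inM AI) => //; exact: coefs_inX.
- rewrite (leq_trans (size_polyD _ _)) // geq_max (leq_trans (size_poly _ _)) // andbT.
  rewrite (leq_trans (size_polyMleq _ _)) // size_polyX addn2 /= ltnS; exact: size_poly.
- have -> : f = x *: F + y *: G.
    apply/polyP => i; rewrite coefD !coefZ !coef_poly.
    case: ltnP => iN; first by have [_ _ ->] := hab i; ring.
    by rewrite nth_default ?(leq_trans sf) // !mulr0 addr0.
  by rewrite !hornerD hornerM !hornerZ hornerX exprS; field.
Qed.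

Lemma ideal_pow_ideal n : is_ideal A (mpow n).
Proof.
have [x [y hxy]] := regular_params hR; have y0 := params_neq0 hxy.
have [mx my hm] := hxy; have [Ax Ay] := (idealS mI mx, idealS mI my).
have AI := subring_ideal sA.
split.
- by move=> u /(ideal_powP _ _ hxy)[f [Af sf ->]]; apply: form_in.
- apply/(ideal_powP _ _ hxy); exists 0; split; rewrite ?size_poly0 ?horner0 ?mulr0 //.
  by move=> i; rewrite coef0; exact: subring0.
- move=> u v /(ideal_powP _ _ hxy)[f [Af sf ->]] /(ideal_powP _ _ hxy)[g [Ag sg ->]].
  apply/(ideal_powP _ _ hxy); exists (f + g); split; first exact: (coefs_inD AI).
    by rewrite (leq_trans (size_polyD _ _)) // geq_max sf.
  by rewrite hornerD mulrDr.
- move=> a v Aa /(ideal_powP _ _ hxy)[g [Ag sg ->]].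
  apply/(ideal_powP _ _ hxy); exists (a *: g); split; first exact: (coefs_inZ AI).
    by rewrite (leq_trans (size_scale_leq _ _)).
  by rewrite hornerZ mulrCA.
Qed.

Lemma ideal_powM n k u v : mpow n u -> mpow k v -> mpow (n + k) (u * v).
Proof.
have [x [y hxy]] := regular_params hR; have AI := subring_ideal sA.
move=> /(ideal_powP _ _ hxy)[f [Af sf ->]] /(ideal_powP _ _ hxy)[g [Ag sg ->]].
apply/(ideal_powP _ _ hxy); exists (f * g); split; first exact: (coefs_inM AI).
  by rewrite (leq_trans (size_polyMleq _ _)) //; lia.
by rewrite hornerM exprD; ring.
Qed.

Lemma ideal_pow_le n k : (n <= k)%N -> mpow k `<=` mpow n.
Proof.
move=> /subnK <-; elim: (k - n)%N => // d IHd u [l [a [b [ma hb ->]]]].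
apply: IHd; apply: (ideal_sum (ideal_pow_ideal _)) => i _.
exact: (idealMl (ideal_pow_ideal _) (idealS mI (ma i)) (hb i)).
Qed.

Lemma ideal_pow1 u : 'm_A u -> mpow 1 u.
Proof.
move=> mu; exists 1%N, (fun=> u), (fun=> 1); split=> //.
  by move=> _; case: sA.
by rewrite big_ord_recr big_ord0 /=; ring.
Qed.

(** Initial forms multiply, and by [coefM_prime] their product is nonzero over the residue field. *)
Lemma ord_eqM n k u v : ord_eq A u n -> ord_eq A v k -> ord_eq A (u * v) (n + k).
Proof.
move=> [un un'] [vk vk']; split; first exact: ideal_powM.
have [x [y hxy]] := regular_params hR; have AI := subring_ideal sA.
move: un un' vk vk' => /(ideal_powP _ _ hxy)[f [Af sf ->]] + /(ideal_powP _ _ hxy)[g [Ag sg ->]].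
rewrite !form_pow_succ // => nf ng.
have -> : y ^+ n * f.[x / y] * (y ^+ k * g.[x / y]) = y ^+ (n + k) * (f * g).[x / y].
  by rewrite hornerM exprD; ring.
rewrite form_pow_succ //; last 2 first.
- exact: (coefs_inM AI).
- by rewrite (leq_trans (size_polyMleq _ _)) //; lia.
by case/(coefM_prime hA Af Ag).
Qed.

Lemma ord_eq_form x y n f : params A x y -> coefs_in A f -> (size f <= n.+1)%N ->
  ~ coefs_in 'm_A f -> ord_eq A (y ^+ n * f.[x / y]) n.
Proof.
by move=> hxy Af sf nf; split; [apply/(ideal_powP _ _ hxy);
  exists f | rewrite form_pow_succ].
Qed.

Lemma not_coefs_in1 (f : {poly K}) i : f`_i = 1 -> ~ coefs_in 'm_A f.
Proof. by move=> fi /(_ i); rewrite fi => /nonunits1. Qed.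

Lemma ord_params x y : params A x y -> ord_eq A x 1.
Proof.
move=> hxy; have y0 := params_neq0 hxy.
have -> : x = y ^+ 1 * 'X.[x / y] by rewrite hornerX; field.
apply: ord_eq_form => //; rewrite ?size_polyX //; first exact: coefs_inX.
by apply: (@not_coefs_in1 _ 1); rewrite coefX.
Qed.

Lemma ord_exists_le n u : A u -> ~ mpow n u -> exists k, ord_eq A u k.
Proof.
move=> Au; elim: n => [|n IHn] //= nu; have [un|] := pselect (mpow n u); last exact: IHn.
by exists n.
Qed.

(** The intersection of the powers of the maximal ideal is zero by Nakayama: each of its elements is
    some [x * w], and [w] is in it again because [x] has order one and orders add. *)
Lemma ord_exists u : A u -> u != 0 -> exists n, ord_eq A u n.
Proof.
move=> Au u0; apply: contrapT => no.
have hu n : mpow n u by apply: contrapT => /(ord_exists_le Au).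
have [x [y hxy]] := regular_params hR; have y0 := params_neq0 hxy.
have [mx my hm] := hxy; have [Ax Ay] := (idealS mI mx, idealS mI my).
have hN : noetherian A by case: hR.
have I0 : is_ideal A [set 0].
  split.
  - by move=> _ ->; exact: subring0.
  - by [].
  - by move=> _ _ -> ->; rewrite addr0.
  - by move=> a _ _ ->; rewrite mulr0.
suff : [set v | forall n, mpow n v] `<=` [set 0] by move/(_ u hu)/eqP; rewrite (negbTE u0).
apply: (principal_nakayama hA hN I0 mx); first by move=> v /(_ 0%N).
move=> v hv; have [w Aw vE] : principal A x v.
  (* Modulo [x] a form of degree [i] is its constant coefficient times [y ^+ i], so [v] lies in
     every [xA + y ^+ i A]. *)
  apply: (principal_krull hA hN (principal_ideal hA Ax) my (hv 0%N)) => i.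
  have /(ideal_powP _ _ hxy)[f [Af sf vE]] := hv i; exists f`_0; split=> //.
  case: i sf vE => [|i] sf vE.
    exists 0; first exact: subring0.
    by rewrite vE (size1_polyC sf) hornerC coefC /=; ring.
  exists (y ^+ i * (drop_poly 1 f).[x / y]).
    by apply: form_in => //; [apply: coefs_in_drop | apply: size_drop1].
  by rewrite vE horner_drop1 exprS; field.
exists w; split; last by rewrite vE subrr.
move=> n; apply: contrapT => /(ord_exists_le Aw)[k ok].
by have [_] := ord_eqM (ord_params hxy) ok; rewrite -vE; apply; apply: hv.
Qed.

Lemma ord_neq0 u n : ord_eq A u n -> u != 0.
Proof. by case=> _ nu; apply/eqP => u0; apply: nu; rewrite u0;
  exact: (ideal0 (ideal_pow_ideal _)). Qed.

(** * The valuation ring of the order function *)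

Local Notation V := (ord_valuation_ring A).

(** Only a lower bound is kept for the order of the numerator, so that zero and sums of fractions
    are treated uniformly. *)
Lemma valuation_ringP u : V u <-> exists n p q, [/\ mpow n p, ord_eq A q n & u = p / q].
Proof.
split=> [[->|[k k0 [p [q [i [j [[pi _] qj -> kE]]]]]]]|[n [p [q [pn [qn qn'] ->]]]]].
- exists 0%N, 0, 1; split; [exact: subring0 | split=> /=;
  first by case: sA | by rewrite mul0r].
  case=> l [a [b [ma Ab e]]]; apply: (@nonunits1 _ A); rewrite e.
  by apply: (ideal_sum mI) => i _; apply: (idealMr mI).
- exists j, p, q; split=> //; apply: (@ideal_pow_le _ i) => //.
  by move: k0; rewrite kE Num.Theory.subr_ge0 lez_nat.
- have [->|p0] := eqVneq p 0; first by left; rewrite mul0r.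
  have [l [pl pl']] := ord_exists (idealS (ideal_pow_ideal n) pn) p0.
  right; exists (l%:Z - n%:Z); last by exists p, q, l, n.
  rewrite Num.Theory.subr_ge0 lez_nat leqNgt; apply/negP => ln; apply: pl'.
  exact: (ideal_pow_le ln).
Qed.

Lemma ideal_pow1E u : mpow 1 u -> 'm_A u.
Proof.
by move=> [l [a [b [ma Ab ->]]]]; apply: (ideal_sum mI) => i _; apply: (idealMr mI).
Qed.

Lemma ord_unit u : A u -> ~ 'm_A u -> ord_eq A u 0.
Proof. by move=> Au nu; split=> // /ideal_pow1E. Qed.

Lemma ord_one : ord_eq A 1 0.
Proof. by apply: ord_unit; [case: sA | exact: nonunits1]. Qed.

Let maxV : set K := [set u | exists n p q, [/\ mpow n.+1 p, ord_eq A q n & u = p / q]].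

Let subringV : subring V.
Proof.
split.
- apply/valuation_ringP; exists 0%N, 1, 1; split;
  [by case: sA | exact: ord_one | by rewrite divr1].
- move=> u v /valuation_ringP[n [p [q [pn qn ->]]]] /valuation_ringP[k [r [s [rk sk ->]]]].
  apply/valuation_ringP; exists (n + k)%N, (p * s - r * q), (q * s); split; last first.
  + have [q0 s0] := (ord_neq0 qn, ord_neq0 sk); by field; rewrite q0 s0.
  + exact: ord_eqM.
  + apply: (idealB sA (ideal_pow_ideal _)).
      by apply: ideal_powM => //; case: sk.
    by rewrite addnC; apply: ideal_powM => //; case: qn.
- move=> u v /valuation_ringP[n [p [q [pn qn ->]]]] /valuation_ringP[k [r [s [rk sk ->]]]].
  apply/valuation_ringP; exists (n + k)%N, (p * r), (q * s); split;
    last by rewrite mulf_div.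
  + exact: ideal_powM.
  + exact: ord_eqM.
Qed.

Let maxV_ideal : is_ideal V maxV.
Proof.
split.
- move=> _ [n [p [q [pn qn ->]]]]; apply/valuation_ringP; exists n, p, q; split=> //.
  exact: ideal_pow_le (leqnSn n) _ pn.
- exists 0%N, 0, 1; split; [exact: (ideal0 (ideal_pow_ideal _)) | exact: ord_one |].
  by rewrite mul0r.
- move=> _ _ [n [p [q [pn qn ->]]]] [k [r [s [rk sk ->]]]].
  exists (n + k)%N, (p * s + r * q), (q * s); split; last first.
  + have [q0 s0] := (ord_neq0 qn, ord_neq0 sk); by field; rewrite q0 s0.
  + exact: ord_eqM.
  + apply: (idealD (ideal_pow_ideal _)).
      by rewrite -addSn; apply: ideal_powM => //; case: sk.
    by rewrite addnC -addSn; apply: ideal_powM => //; case: qn.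
- move=> u _ /valuation_ringP[n [p [q [pn qn ->]]]] [k [r [s [rk sk ->]]]].
  exists (n + k)%N, (p * r), (q * s); split; last by rewrite mulf_div.
  + by rewrite -addnS; apply: ideal_powM.
  + exact: ord_eqM.
Qed.

Lemma valuation_nonunitsP u :
  'm_V u <-> exists n p q, [/\ mpow n.+1 p, ord_eq A q n & u = p / q].
Proof.
split=> [[Vu nVu]|mu].
  apply: contrapT => nu; apply: nVu.
  move: Vu => /valuation_ringP[n [p [q [pn qn uE]]]].
  have pn' : ord_eq A p n by split=> // pS; apply: nu; exists n, p, q.
  have [p0 q0] := (ord_neq0 pn', ord_neq0 qn).
  exists (q / p); last by rewrite uE mulf_div [q * p]mulrC divff ?mulf_neq0.
  by apply/valuation_ringP; exists n, q, p; split=> //; case: qn.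
split; first exact: (idealS maxV_ideal mu).
case=> v Vv uv.
have [n [p [q [pn qn]]]] : maxV 1 by rewrite -uv; apply: (idealMr maxV_ideal).
move/(congr1 ( *%R^~ q)); rewrite mul1r divfK ?(ord_neq0 qn) // => qp.
by case: qn => _; rewrite qp.
Qed.

Lemma valuation_local : local_ring V.
Proof.
have mE : 'm_V = maxV by apply/seteqP; split=> u /valuation_nonunitsP.
have [V1 VB VM] := subringV; split; last by rewrite mE.
by split=> [|u v|u v]; rewrite !inE //; [exact: VB | exact: VM].
Qed.

Lemma nonunits_sub_valuation : 'm_A `<=` 'm_V.
Proof.
move=> u mu; apply/valuation_nonunitsP; exists 0%N, u, 1.
by split; [exact: ideal_pow1 | exact: ord_one | rewrite divr1].
Qed.

Lemma valuation_unit p q n : ord_eq A p n -> ord_eq A q n -> V (p / q) /\ ~ 'm_V (p / q).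
Proof.
move=> pn qn; have [p0 q0] := (ord_neq0 pn, ord_neq0 qn).
have Vpq r s : ord_eq A r n -> ord_eq A s n -> V (r / s).
  by move=> [rn _] sn; apply/valuation_ringP; exists n, r, s.
split; first exact: Vpq.
have pq0 : p / q != 0 by rewrite mulf_neq0 ?invr_eq0.
move=> /inv_notin_nonunits /(_ pq0); apply.
by rewrite invf_div; apply: Vpq.
Qed.

End RegularLocalRings.

(** * Quadratic transforms *)

Section Localization.
Variables (K : fieldType) (B P : set K).
Hypotheses (sB : subring B) (PI : is_ideal B P) (P1 : ~ P 1).

Lemma maximal_unit u : is_maximal_ideal B P -> B u -> ~ P u ->
  exists2 b, B b & P (1 - b * u).
Proof.
move=> [_ _ hmax] Bu nPu; apply: contrapT => no.
pose J : set K := [set v | B v /\ exists2 b, B b & P (v - b * u)].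
have JI : is_ideal B J.
  split.
  - by move=> v [].
  - split; first exact: subring0.
    by exists 0; [exact: subring0 | rewrite mul0r subrr; exact: (ideal0 PI)].
  - move=> v w [Bv [b Bb Pb]] [Bw [c Bc Pc]]; split; first exact: subringD.
    exists (b + c); first exact: subringD.
    have -> : v + w - (b + c) * u = (v - b * u) + (w - c * u) by ring.
    exact: (idealD PI).
  - move=> a v Ba [Bv [b Bb Pb]]; split; first exact: subringM.
    exists (a * b); first exact: subringM.
    by rewrite -mulrA -mulrBr; apply: (idealMl PI).
apply: nPu; rewrite -(hmax J JI); first split=> //.
- by exists 1; [case: sB | rewrite mul1r subrr; exact: (ideal0 PI)].
- by case=> _ [b Bb Pb]; apply: no; exists b.
- move=> v Pv; split; first exact: (idealS PI).
  by exists 0; [exact: subring0 | rewrite mul0r subr0].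
Qed.

Lemma maximal_prime u v : is_maximal_ideal B P -> B u -> B v ->
  P (u * v) -> P u \/ P v.
Proof.
move=> hmax Bu Bv Puv; apply: contrapT => /not_orP[nu]; apply.
have [b Bb Pb] := maximal_unit hmax Bu nu.
have -> : v = (1 - b * u) * v + b * (u * v) by ring.
by apply: (idealD PI); [apply: (idealMr PI) | apply: (idealMl PI)].
Qed.

Hypothesis Pprime : forall u v, B u -> B v -> P (u * v) -> P u \/ P v.
Local Notation L := (localization B P).

Let notinP_neq0 u : ~ P u -> u != 0.
Proof. by move=> nu; apply/eqP => u0; apply: nu; rewrite u0; exact: (ideal0 PI). Qed.

Let notinPM u v : B u -> B v -> ~ P u -> ~ P v -> ~ P (u * v).
Proof. by move=> Bu Bv nu nv /(Pprime Bu Bv)[]. Qed.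

Lemma sub_localization : B `<=` L.
Proof. by move=> u Bu; exists u, 1; split=> //; [case: sB | rewrite divr1]. Qed.

Lemma localization_inv u : B u -> ~ P u -> L u^-1.
Proof. by move=> Bu nu; exists 1, u; split=> //; [case: sB | rewrite mul1r]. Qed.

Let subringL : subring L.
Proof.
split.
- by apply: sub_localization; case: sB.
- move=> _ _ [a [b [Ba Bb nb ->]]] [c [d [Bc Bd nd ->]]].
  exists (a * d - c * b), (b * d); split.
  + by case: (sB) => _ BB BM; apply: BB; apply: BM.
  + exact: subringM.
  + exact: notinPM.
  + have [b0 d0] := (notinP_neq0 nb, notinP_neq0 nd); by field; rewrite b0 d0.
- move=> _ _ [a [b [Ba Bb nb ->]]] [c [d [Bc Bd nd ->]]].
  exists (a * c), (b * d); split; [exact: subringM | exact: subringM | exact: notinPM |].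
  by rewrite mulf_div.
Qed.

Lemma localization_nonunitsP u :
  'm_L u <-> exists a b, [/\ P a, B b, ~ P b & u = a / b].
Proof.
split=> [[[a [b [Ba Bb nb uE]]] nu]|[a [b [Pa Bb nb ->]]]].
  exists a, b; split=> //; apply: contrapT => na; apply: nu.
  have [a0 b0] := (notinP_neq0 na, notinP_neq0 nb).
  exists (b / a); first by exists b, a.
  by rewrite uE mulf_div [b * a]mulrC divff ?mulf_neq0.
split; first by exists a, b; split=> //; apply: (idealS PI).
case=> _ [c [d [Bc Bd nd ->]]].
have [b0 d0] := (notinP_neq0 nb, notinP_neq0 nd).
rewrite mulf_div => /(congr1 ( *%R^~ (b * d))); rewrite mul1r divfK ?mulf_neq0 // => e.
by apply: (notinPM Bb Bd nb nd); rewrite -e; apply: (idealMr PI).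
Qed.

Lemma localization_local : local_ring L.
Proof.
have [L1 LB LM] := subringL; split.
  by split=> [|u v|u v]; rewrite !inE //; [exact: LB | exact: LM].
split.
- by move=> u [].
- apply/localization_nonunitsP; exists 0, 1.
  by split=> //; [exact: (ideal0 PI) | case: sB | rewrite mul0r].
- move=> u v /localization_nonunitsP[a [b [Pa Bb nb ->]]] /localization_nonunitsP[c [d [Pc Bd nd ->]]].
  apply/localization_nonunitsP; exists (a * d + c * b), (b * d); split.
  + by apply: (idealD PI); apply: (idealMr PI).
  + exact: subringM.
  + exact: notinPM.
  + have [b0 d0] := (notinP_neq0 nb, notinP_neq0 nd); by field; rewrite b0 d0.
- move=> _ v [a [b [Ba Bb nb ->]]] /localization_nonunitsP[c [d [Pc Bd nd ->]]].
  apply/localization_nonunitsP; exists (a * c), (b * d); split.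
  + exact: (idealMl PI).
  + exact: subringM.
  + exact: notinPM.
  + by rewrite mulf_div.
Qed.

End Localization.

(** * Adjunction of an element, and domination *)

Definition adjoin (K : fieldType) (A : set K) (t : K) : set K :=
  [set u | exists2 f : {poly K}, coefs_in A f & u = f.[t]].

Lemma adjoin_subring (K : fieldType) (A : set K) t : subring A -> subring (adjoin A t).
Proof.
move=> sA; have AI := subring_ideal sA; split.
- by exists 1%:P; [exact: coefs_in1 | rewrite hornerC].
- move=> _ _ [f Af ->] [g Ag ->]; exists (f - g); first exact: (coefs_inB sA AI).
  by rewrite hornerD hornerN.
- move=> _ _ [f Af ->] [g Ag ->]; exists (f * g); first exact: (coefs_inM AI).
  by rewrite hornerM.
Qed.

Lemma sub_adjoin (K : fieldType) (A : set K) t : subring A -> A `<=` adjoin A t.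
Proof.
move=> sA u Au; exists u%:P; last by rewrite hornerC.
exact: (coefs_inC (subring_ideal sA)).
Qed.

Lemma mem_adjoin (K : fieldType) (A : set K) t : subring A -> adjoin A t t.
Proof. by move=> sA; exists 'X; [exact: coefs_inX | rewrite hornerX]. Qed.

(* The condition for [u = 0] is vacuous, since [0^-1 = 0]. *)
Definition dominated (K : fieldType) (A B : set K) : Prop :=
  A `<=` B /\ forall u, A u -> B u^-1 -> A u^-1.

Lemma dominated_refl (K : fieldType) (A : set K) : dominated A A.
Proof. by split. Qed.

Lemma dominated_trans (K : fieldType) (A B C : set K) :
  dominated A B -> dominated B C -> dominated A C.
Proof.
move=> [AB hAB] [BC hBC]; split=> [u /AB /BC //|u Au Cu].
by apply: hAB => //; apply: hBC => //; apply: AB.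
Qed.

Lemma dominated_nonunits (K : fieldType) (A B : set K) u :
  local_ring A -> local_ring B -> dominated A B -> 'm_A u -> 'm_B u.
Proof.
move=> hA hB [AB hAB] mu; have [->|u0] := eqVneq u 0.
  exact: (ideal0 (nonunits_ideal hB)).
have Au : A u := idealS (nonunits_ideal hA) mu.
apply: contrapT => /(unit_inv (AB _ Au))[_ /(hAB u Au)].
exact: inv_notin_nonunits.
Qed.

Lemma unit_sub (K : fieldType) (A B : set K) u :
  local_ring A -> A `<=` B -> A u -> ~ 'm_A u -> ~ 'm_B u.
Proof.
move=> hA AB Au nu; have [u0 Au'] := unit_inv Au nu.
by move=> /inv_notin_nonunits /(_ u0); apply; apply: AB.
Qed.

(** * Charts of the blowing-up and their closed points *)

Section QuadraticTransforms.
Variables (K : fieldType) (A : set K).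
Hypothesis hR : regular_local_ring 2 A.
Let hA : local_ring A := regular_local hR.
Let sA : subring A := local_subring hA.
Let mI : is_ideal A 'm_A := nonunits_ideal hA.
Let AI : is_ideal A A := subring_ideal sA.

Lemma blowup_chartE t z : params A t z -> blowup_chart A z = adjoin A (t / z).
Proof.
move=> htz; have z0 := params_neq0 hR htz; apply/seteqP; split=> u.
  move=> [n [w [wn ->]]]; move: wn => /(ideal_powP hR _ _ htz)[f [Af sf ->]].
  by exists f => //; rewrite mulrAC divff ?mul1r ?expf_neq0.
move=> [f Af ->]; exists (size f), (z ^+ (size f) * f.[t / z]); split.
  by apply/(ideal_powP hR _ _ htz); exists f.
by rewrite mulrAC divff ?mul1r ?expf_neq0.
Qed.

Lemma mem_blowup_chart z w : 'm_A w -> blowup_chart A z (w / z).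
Proof. by move=> mw; exists 1%N, w; split; rewrite ?expr1 //; apply: ideal_pow1. Qed.

(** Write [z = a * x + b * y]. If [a] and [b] were both nonunits, [1 = a * (x / z) + b * (y / z)]
    would lie in [P]; if one is a unit, [z] can replace the corresponding parameter. *)
Lemma chart_params z P : 'm_A z -> z != 0 -> is_ideal (blowup_chart A z) P ->
  ~ P 1 -> 'm_A `<=` P -> exists t, params A t z.
Proof.
move=> mz z0 PI P1 mP; have [x [y hxy]] := regular_params hR.
have [mx my hm] := hxy; have [Ax Ay] := (idealS mI mx, idealS mI my).
have [a [b [Aa Ab zE]]] := hm z mz.
have gen c d w v : A d -> A c -> ~ 'm_A c -> 'm_A w -> 'm_A v -> z = c * w + d * v ->
    (forall u, 'm_A u -> exists a b, [/\ A a, A b & u = a * w + b * v]) -> params A v z.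
  move=> Ad Ac nc mw mv zcd gwv; have [c0 Ac'] := unit_inv Ac nc.
  split=> // u /gwv[e [f [Ae Af ->]]]; exists (f - e * c^-1 * d), (e * c^-1); split.
  - by apply: (idealB sA AI) => //; repeat apply: (subringM sA).
  - exact: subringM.
  - by rewrite zcd; field.
have [ma|na] := pselect ('m_A a); last by exists y; apply: (gen a b x y).
have [mb|nb] := pselect ('m_A b); last first.
  exists x; apply: (gen b a y x) => //; first by rewrite addrC.
  by move=> u /hm[e [f [Ae Af ->]]]; exists f, e; split=> //; exact: addrC.
case: P1; have -> : 1 = a * (x / z) + b * (y / z) by rewrite !mulrA -mulrDl -zE divff.
apply: (idealD PI); apply: (idealMr PI);
  [exact: mP | exact: mem_blowup_chart | exact: mP | exact: mem_blowup_chart].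
Qed.

Definition chart_point (B : set K) (t z : K) (P : set K) : Prop :=
  [/\ params A t z, is_maximal_ideal (adjoin A (t / z)) P, 'm_A `<=` P
    & B = localization (adjoin A (t / z)) P].

Lemma N1P B : N1 A B <-> exists t z P, chart_point B t z P.
Proof.
split=> [[z [P [mz z0 hP mP ->]]]|[t [z [P [htz hP mP ->]]]]].
  have [PI P1 _] := hP; have [t htz] := chart_params mz z0 PI P1 mP.
  by exists t, z, P; split=> //; rewrite -(blowup_chartE htz).
exists z, P; split=> //; rewrite ?(blowup_chartE htz) //; first by case: htz.
exact: (params_neq0 hR htz).
Qed.

Section ChartPoint.
Variables (B P : set K) (t z : K).
Hypothesis hB : chart_point B t z P.
Local Notation D := (adjoin A (t / z)).

Let sD : subring D := adjoin_subring (t / z) sA.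

Lemma chart_ideal : is_ideal D P. Proof. by case: hB => _ []. Qed.
Lemma chart_proper : ~ P 1. Proof. by case: hB => _ []. Qed.
Lemma chart_prime u v : D u -> D v -> P (u * v) -> P u \/ P v.
Proof. by move=> Du Dv; apply: (maximal_prime sD chart_ideal) => //; case: hB. Qed.

Lemma chart_mem w : 'm_A w -> D (w / z).
Proof.
by move=> mw; case: hB => htz _ _ _; rewrite -(blowup_chartE htz); apply: mem_blowup_chart.
Qed.

Lemma chart_sub : D `<=` B.
Proof. by case: hB => _ _ _ ->; exact: (sub_localization sD chart_proper). Qed.

Lemma chart_inv u : D u -> ~ P u -> B u^-1.
Proof. by case: hB => _ _ _ ->; exact: (localization_inv sD). Qed.

Lemma chart_local : local_ring B.
Proof. by case: hB => _ _ _ ->;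
  exact: (localization_local sD chart_ideal chart_proper chart_prime). Qed.

Lemma chart_nonunitsP u : 'm_B u <-> exists a b, [/\ P a, D b, ~ P b & u = a / b].
Proof. by case: hB => _ _ _ ->;
  exact: (localization_nonunitsP chart_ideal chart_prime). Qed.

Lemma chart_nonunits u : P u -> 'm_B u.
Proof.
move=> Pu; apply/chart_nonunitsP; exists u, 1; split; rewrite ?divr1 //; first by case: sD.
exact: chart_proper.
Qed.

Lemma chart_dominated : dominated A B.
Proof.
have AB u : A u -> B u by move=> Au; apply/chart_sub/(sub_adjoin _ sA).
split=> // u Au Bu; have [->|u0] := eqVneq u 0; first by rewrite invr0; exact: subring0.
have [mu|/(unit_inv Au)[]//] := pselect ('m_A u).
have /chart_nonunits mBu : P u by case: hB => _ _ mP _; apply: mP.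
by case: (inv_notin_nonunits mBu u0).
Qed.

End ChartPoint.

Lemma N1_local B : N1 A B -> local_ring B.
Proof. by move=> /N1P[t [z [P hB]]]; exact: (chart_local hB). Qed.

Lemma N1_dominated B : N1 A B -> dominated A B.
Proof. by move=> /N1P[t [z [P hB]]]; exact: (chart_dominated hB). Qed.

(** The ratio [z' / z] is in [B] and its inverse in [B'], so it is a unit of [U] and, by domination,
    of [B']. Powers of [z] in denominators can thus be exchanged for powers of [z'], and the inverse
    of the remaining denominator passes from [B] through [U] to [B']. *)
Lemma N1_unique_sub B B' U : local_ring U -> N1 A B -> N1 A B' ->
  dominated B U -> dominated B' U -> B `<=` B'.
Proof.
move=> hU /N1P[t [z [P hB]]] /N1P[t' [z' [P' hB']]] [BU domB] [BU' domB'] u.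
have [[htz _ _ BE] [htz' _ _ BE']] := (hB, hB').
have [z0 z0'] := (params_neq0 hR htz, params_neq0 hR htz').
have [sB' sU] := (local_subring (chart_local hB'), local_subring hU).
have [_ mz _] := htz; have [_ mz' _] := htz'.
have Bz : B (z' / z) := chart_sub hB (chart_mem hB mz').
have Bz' : B' (z / z') := chart_sub hB' (chart_mem hB' mz).
have Bz'' : B' (z' / z).
  by rewrite -invf_div; apply: domB' => //; rewrite invf_div; apply: BU.
have chartB' n w : ideal_pow A 'm_A n w -> B' (w / z' ^+ n).
  by move=> wn; apply: (chart_sub hB'); rewrite -(blowup_chartE htz'); exists n, w.
rewrite {1}BE => -[a [b [Da Db nPb ->]]].
have Bb := chart_inv hB Db nPb.
have b0 : b != 0 by apply/eqP => b0; apply: nPb; rewrite b0;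
  exact: (ideal0 (chart_ideal hB)).
move: Da Db b0 Bb; rewrite -(blowup_chartE htz) => -[n [w [wn ->]]] [k [v [vk ->]]] b0 Bb.
have v0 : v != 0 by apply: contraNneq b0 => ->; rewrite mul0r.
have [zk0 zk0'] := (expf_neq0 k z0, expf_neq0 k z0').
have Bv : B' (v / z' ^+ k)^-1.
  apply: domB'; first exact: chartB'.
  have -> : (v / z' ^+ k)^-1 = (v / z ^+ k)^-1 * (z' / z) ^+ k.
    by rewrite expr_div_n; field; rewrite v0 zk0 zk0'.
  by apply: (subringM sU); [apply: BU | apply: (subringX _ sU); apply: BU].
have -> : w / z ^+ n / (v / z ^+ k) =
  w / z' ^+ n * (z' / z) ^+ n * (z / z') ^+ k * (v / z' ^+ k)^-1.
  have [zn0 zn0'] := (expf_neq0 n z0, expf_neq0 n z0').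
  by rewrite !expr_div_n; field; rewrite v0 zk0 zk0' zn0 zn0'.
apply: (subringM sB') => //; apply: (subringM sB'); last exact: subringX.
by apply: (subringM sB'); [exact: chartB' | exact: subringX].
Qed.

Lemma N1_unique B B' U : local_ring U -> N1 A B -> N1 A B' ->
  dominated B U -> dominated B' U -> B = B'.
Proof.
by move=> hU N N' d d'; apply/seteqP; split; apply: (N1_unique_sub hU).
Qed.

End QuadraticTransforms.

(** * Transversal parameters *)

(* For [V = V_S]: the strict transform at [T] of the exceptional curve of [S] is
   [x = 0]. *)
Definition transversal (K : fieldType) (V T : set K) (x y : K) : Prop :=
  [/\ T `<=` V, params T x y, 'm_V x & ~ 'm_V y].

(** This is the ideal [(y, x / y)] of [T[x / y]]: modulo [x / y] only the constant coefficient is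
    left, and [x = (x / y) * y]. *)
Definition star_ideal (K : fieldType) (T : set K) (x y : K) : set K :=
  [set u | exists g, [/\ coefs_in T g, 'm_T g`_0 & u = g.[x / y]]].

(* The local ring of the blowing-up of [T] at its point on the strict transform
   of [x = 0]; it is [T*] when [x] is as in [transversal]. *)
Definition star (K : fieldType) (T : set K) (x y : K) : set K :=
  localization (adjoin T (x / y)) (star_ideal T x y).

(** * The quadratic transform on the strict transform of a parameter curve *)

Section Star.
Variables (K : fieldType) (T : set K) (x y : K).
Hypotheses (hR : regular_local_ring 2 T) (hxy : params T x y).
Let hT : local_ring T := regular_local hR.
Let sT : subring T := local_subring hT.
Let mI : is_ideal T 'm_T := nonunits_ideal hT.
Let TI : is_ideal T T := subring_ideal sT.
Local Notation D := (adjoin T (x / y)).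
Let sD : subring D := adjoin_subring (x / y) sT.
Let mx : 'm_T x. Proof. by case: hxy. Qed.
Let my : 'm_T y. Proof. by case: hxy. Qed.
Let x0 : x != 0 := params_neq0 hR (params_sym hxy).
Let y0 : y != 0 := params_neq0 hR hxy.
Let D_drop g : coefs_in T g -> D (drop_poly 1 g).[x / y].
Proof. by move=> Tg; exists (drop_poly 1 g) => //; exact: coefs_in_drop. Qed.

(** Two polynomials with the same value at [x / y] differ by coefficients in the maximal ideal, so
    the residue of the constant coefficient is well defined. *)
Lemma star_idealE g : coefs_in T g -> star_ideal T x y g.[x / y] -> 'm_T g`_0.
Proof.
move=> Tg [h [Th h0 gh]]; have : coefs_in 'm_T (g - h).
  apply: (params_independent hR hxy); first exact: (coefs_inB sT TI).
  by rewrite hornerD hornerN gh subrr.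
by move=> /(_ 0%N); rewrite coefB => /(idealD mI) /(_ h0); rewrite subrK.
Qed.

Lemma star_maximal : is_maximal_ideal D (star_ideal T x y).
Proof.
have PI : is_ideal D (star_ideal T x y).
  split.
  - by move=> _ [g [Tg _ ->]]; exists g.
  - exists 0; split; [by move=> i; rewrite coef0; exact: subring0 | | by rewrite horner0].
    by rewrite coef0; exact: (ideal0 mI).
  - move=> _ _ [g [Tg g0 ->]] [h [Th h0 ->]]; exists (g + h); split.
    + exact: (coefs_inD TI).
    + by rewrite coefD; apply: (idealD mI).
    + by rewrite hornerD.
  - move=> _ _ [g Tg ->] [h [Th h0 ->]]; exists (g * h); split.
    + exact: (coefs_inM TI).
    + by rewrite coef0M; apply: (idealMl mI).
    + by rewrite hornerM.
split=> //.
  rewrite -[1](hornerC _ (x / y)) => /(star_idealE (coefs_in1 sT)).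
  by rewrite coefC /=; exact: nonunits1.
move=> J JI J1 PJ; apply/seteqP; split=> // u Ju.
have [g Tg uE] := idealS JI Ju.
exists g; split=> //; apply: contrapT => ng; apply: J1.
have [g0 Tg'] := unit_inv (Tg 0%N) ng.
(* The constant coefficient differs from [u] by a multiple of [x / y], hence by an element of [J];
   being a unit of [T], it forces [1] into [J]. *)
have Jg0 : J g`_0.
  have -> : g`_0 = g.[x / y] - (drop_poly 1 g * 'X).[x / y].
    by rewrite (horner_drop1 g (x / y)) hornerM hornerX; ring.
  apply: (idealB sD JI); first by rewrite -uE.
  apply: PJ; exists (drop_poly 1 g * 'X); split=> //.
    by apply: (coefs_inM TI); [exact: coefs_in_drop | exact: coefs_inX].
  by rewrite coefMX; exact: (ideal0 mI).
by rewrite -(mulVf g0); apply: (idealMl JI) => //; apply: (sub_adjoin _ sT).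
Qed.

Lemma star_chart_point : chart_point T (star T x y) x y (star_ideal T x y).
Proof.
split=> //; first exact: star_maximal.
move=> u mu; exists u%:P; split; last by rewrite hornerC.
  exact: (coefs_inC TI (idealS mI mu)).
by rewrite coefC.
Qed.

Lemma star_N1 : N1 T (star T x y).
Proof. by apply/(N1P hR); exists x, y, (star_ideal T x y); exact: star_chart_point. Qed.

Lemma star_local : local_ring (star T x y).
Proof. exact: (N1_local hR star_N1). Qed.

Lemma star_mem u : star T x y u <->
  exists g h, [/\ coefs_in T g, coefs_in T h, ~ 'm_T h`_0 & u = g.[x / y] / h.[x / y]].
Proof.
split=> [[_ [_ [[g Tg ->] [h Th ->] nh ->]]]|[g [h [Tg Th nh ->]]]].
  by exists g, h; split=> // h0; apply: nh; exists h.
exists g.[x / y], h.[x / y]; split; [by exists g | by exists h | | by []].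
by move=> /(star_idealE Th).
Qed.

Lemma star_ratio : star T x y (x / y).
Proof. by apply: (chart_sub hR star_chart_point); exact: mem_adjoin. Qed.

Lemma star_ratio_nonunit : 'm_(star T x y) (x / y).
Proof.
apply: (chart_nonunits hR star_chart_point); exists 'X.
by split; [exact: coefs_inX | rewrite coefX; exact: (ideal0 mI) | rewrite hornerX].
Qed.

Lemma star_proper : T `<` star T x y.
Proof.
split; first by have [] := chart_dominated hR star_chart_point.
move/(_ _ star_ratio) => Txy; apply: (regular_pow_notin hR (n := 1) hxy).
by exists (x / y) => //; rewrite expr1 mulrC divfK.
Qed.

(** A numerator is a multiple of [x / y] plus its constant coefficient [a * x + b * y], which equals
    [(a * (x / y) + b) * y]. *)
Lemma star_params : params (star T x y) (x / y) y.
Proof.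
split; first exact: star_ratio_nonunit.
  by apply: (dominated_nonunits hT star_local _ my);
    exact: (chart_dominated hR star_chart_point).
have sS := local_subring star_local.
have TS : T `<=` star T x y by case: star_proper.
move=> u /(chart_nonunitsP hR star_chart_point)[_ [h [[g [Tg g0 ->]] Dh nh ->]]].
have Sh : star T x y h^-1 := chart_inv hR star_chart_point Dh nh.
have [a [b [Ta Tb gE]]] : exists a b, [/\ T a, T b & g`_0 = a * x + b * y].
  by case: hxy => _ _; apply.
exists ((drop_poly 1 g).[x / y] * h^-1), ((a * (x / y) + b) * h^-1); split.
- by apply: (subringM sS) => //; apply: (chart_sub hR star_chart_point); exact: D_drop.
- apply: (subringM sS) => //; apply: (subringD sS); last exact: TS.
  by apply: (subringM sS); [exact: TS | exact: star_ratio].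
- rewrite horner_drop1 gE.
  have -> : a * x + b * y = (a * (x / y) + b) * y by field.
  by ring.
Qed.

(** Since [x / y] has residue zero, a fraction has the residue of the quotient of the constant
    coefficients: the residue field does not grow. *)
Lemma star_residue u : star T x y u -> exists a, T a /\ 'm_(star T x y) (u - a).
Proof.
move=> /star_mem[g [h [Tg Th nh ->]]]; have [h0 Th'] := unit_inv (Th 0%N) nh.
have Ta : T (g`_0 / h`_0) by apply: (subringM sT).
exists (g`_0 / h`_0); split=> //.
apply/(chart_nonunitsP hR star_chart_point).
have nhx : ~ star_ideal T x y h.[x / y] by move=> /(star_idealE Th).
exists (g - (g`_0 / h`_0) *: h).[x / y], h.[x / y]; split=> //.
- exists (g - (g`_0 / h`_0) *: h); split=> //.
    by apply: (coefs_inB sT TI) => //; apply: (coefs_inZ TI).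
  by rewrite coefB coefZ divfK // subrr; exact: (ideal0 mI).
- by exists h.
- have hx0 : h.[x / y] != 0.
    by apply/eqP => e; apply: nhx; rewrite e;
      exact: (ideal0 (chart_ideal star_chart_point)).
  by rewrite hornerD hornerN hornerZ mulrBl mulfK.
Qed.

Section InLocalRing.
Variable B : set K.
Hypotheses (hB : local_ring B) (TB : T `<=` B) (mBt : 'm_B (x / y)).
Let mBI : is_ideal B 'm_B := nonunits_ideal hB.
Let sB : subring B := local_subring hB.

Let B_horner g : coefs_in T g -> B g.[x / y].
Proof.
move=> Tg; apply: (horner_ideal sB (subring_ideal sB)); last exact: (idealS mBI mBt).
exact: (coefs_in_sub TB).
Qed.

Let B_tail g : coefs_in T g -> 'm_B (g.[x / y] - g`_0).
Proof.
move=> Tg; rewrite horner_drop1 addrK; apply: (idealMl mBI) => //.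
by apply: B_horner; exact: coefs_in_drop.
Qed.

(** Modulo ['m_B] the denominator is its constant coefficient, a unit of [T], so it is invertible in
    [B]. *)
Lemma star_sub : star T x y `<=` B.
Proof.
move=> _ /star_mem[g [h [Tg Th nh ->]]]; apply: (subringM sB); first exact: B_horner.
have [] // := unit_inv (B_horner Th) _; move=> mh.
apply: (unit_sub hT TB (Th 0%N) nh).
rewrite -(subKr h.[x / y] h`_0); apply: (idealB sB mBI) => //.
exact: B_tail.
Qed.

Lemma star_dominated : dominated T B -> dominated (star T x y) B.
Proof.
move=> dTB; split; first exact: star_sub.
move=> _ /star_mem[g [h [Tg Th nh ->]]]; set u := _ / _ => Bu.
have [u0|u0] := eqVneq u 0.
  by rewrite u0 invr0; exact: (subring0 (local_subring star_local)).
have [mg|ng] := pselect ('m_T g`_0); last first.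
  by apply/star_mem; exists h, g; split=> //; rewrite invf_div.
have mg' : 'm_B g.[x / y].
  rewrite -(subrK g`_0 g.[x / y]); apply: (idealD mBI); first exact: B_tail.
  exact: (dominated_nonunits hT hB).
case: (inv_notin_nonunits (A := B) (u := u) _ u0 Bu).
apply: (idealMr mBI) => //; apply: star_sub.
apply/star_mem; exists 1%:P, h; split=> //; first exact: coefs_in1.
by rewrite hornerC mul1r.
Qed.

End InLocalRing.

(** The centre of [B] lies on the strict transform of [x = 0]: otherwise [z / x] would be in [B],
    hence in [V], and [y = (y / z) * (z / x) * x] would be a nonunit of [V]. *)
Lemma chart_center V B t z P : local_ring V -> transversal V T x y ->
  chart_point T B t z P -> B `<=` V -> P (x / z).
Proof.
move=> hV [TV _ mVx nVy] hB BV; have mVI := nonunits_ideal hV.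
have [htz _ _ _] := hB; have [_ mz _] := htz; have z0 := params_neq0 hR htz.
have Dx := chart_mem hR hB mx; have Dy := chart_mem hR hB my.
apply: contrapT => nx; apply: nVy.
have Vz : V (z / x) by apply: BV; rewrite -invf_div; exact: (chart_inv hR hB).
have Vy : V (y / z) by apply: BV; exact: (chart_sub hR hB).
have -> : y = y / z * (z / x * x) by field; rewrite x0 z0.
by apply: (idealMl mVI) => //; apply: (idealMl mVI).
Qed.

Lemma chart_cover B t z P : chart_point T B t z P -> ~ (P (x / z) /\ P (y / z)).
Proof.
move=> hB [Px Py]; have [htz _ _ _] := hB; have [_ mz _] := htz.
have z0 := params_neq0 hR htz.
have [a [b [Ta Tb zE]]] : exists a b, [/\ T a, T b & z = a * x + b * y].
  by case: hxy => _ _; apply.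
apply: (chart_proper hB); have PI := chart_ideal hB.
have -> : 1 = a * (x / z) + b * (y / z) by rewrite !mulrA -mulrDl -zE divff.
by apply: (idealD PI); apply: (idealMl PI) => //; apply: (sub_adjoin _ sT).
Qed.

(** By the two preceding lemmas [x / z] is in [P] and [y / z] is not, so [x / y] is a nonunit of
    [B]. Then [B] dominates both itself and the star, and [N1_unique] applies with [U := B]. *)
Lemma star_unique V B : local_ring V -> transversal V T x y -> N1 T B ->
  B `<=` V -> B = star T x y.
Proof.
move=> hV hTr NB BV; have [t [z [P hB]]] := (N1P hR B).1 NB.
have [TV _ mVx nVy] := hTr.
have [htz _ _ _] := hB; have z0 := params_neq0 hR htz.
have Px := chart_center hV hTr hB BV.
have nPy : ~ P (y / z) by move=> Py; apply: (chart_cover hB).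
have hBl := chart_local hR hB; have mBI := nonunits_ideal hBl.
have Bt : 'm_B (x / y).
  have -> : x / y = x / z * (y / z)^-1 by field; rewrite y0 z0.
  apply: (idealMr mBI); first exact: (chart_nonunits hR hB).
  by apply: (chart_inv hR hB) => //; exact: (chart_mem hR hB).
have dB := chart_dominated hR hB.
apply: (N1_unique hR hBl NB star_N1 (dominated_refl B)).
by apply: star_dominated => //; case: dB.
Qed.

Lemma star_transversal V : local_ring V -> transversal V T x y ->
  transversal V (star T x y) (x / y) y.
Proof.
move=> hV [TV _ mVx nVy]; have [_ Vy] := unit_inv (TV _ (idealS mI my)) nVy.
have mVt : 'm_V (x / y) by apply: (idealMr (nonunits_ideal hV)).
by split=> //; [exact: (star_sub hV) | exact: star_params].
Qed.

Lemma star_transversal_exceptional :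
  transversal (ord_valuation_ring T) (star T x y) y (x / y).
Proof.
have ord_y := ord_params hR (params_sym hxy); have ord_x := ord_params hR hxy.
split.
- move=> _ /star_mem[g [h [Tg Th nh ->]]].
  (* Multiplication by [y ^+ n] makes numerator and denominator forms of degree [n]; the denominator
     has order exactly [n] because its polynomial has a unit constant coefficient. *)
  set n := maxn (size g) (size h).
  have -> : g.[x / y] / h.[x / y] = (y ^+ n * g.[x / y]) / (y ^+ n * h.[x / y]).
    by rewrite -mulf_div divff ?mul1r ?expf_neq0.
  apply/(valuation_ringP hR); exists n, (y ^+ n * g.[x / y]), (y ^+ n * h.[x / y]).
  split=> //.
    by apply/(ideal_powP hR _ _ hxy); exists g; split=> //; rewrite leqW // leq_maxl.
  apply: (ord_eq_form hR hxy Th); first by rewrite leqW // leq_maxr.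
  by move=> /(_ 0%N) /nh.
- exact: (params_sym star_params).
- exact: (nonunits_sub_valuation hR my).
- by have [] := valuation_unit hR ord_x ord_y.
Qed.

End Star.

(** By [chart_center] a common point would have [x / z] and [y / z] in its ideal, against
    [chart_cover]. *)
Lemma transversal_separated (K : fieldType) (T V W B : set K) x y :
  regular_local_ring 2 T -> local_ring V -> local_ring W ->
  transversal V T x y -> transversal W T y x -> N1 T B ->
  ~ (B `<=` V /\ B `<=` W).
Proof.
move=> hR hV hW hVT hWT /(N1P hR)[t [z [P hB]]] [BV BW].
have [_ hxy _ _] := hVT.
have Px := chart_center hR hxy hV hVT hB BV.
have Py := chart_center hR (params_sym hxy) hW hWT hB BW.
exact: (chart_cover hR hxy hB).
Qed.

(** * Parameters at a closed point of the exceptional curve *)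

Section ExceptionalCurve.
Variables (K : fieldType) (A B P : set K) (t z : K).
Hypotheses (hR : regular_local_ring 2 A) (hB : chart_point A B t z P).
Let hA : local_ring A := regular_local hR.
Let sA : subring A := local_subring hA.
Let mI : is_ideal A 'm_A := nonunits_ideal hA.
Let AI : is_ideal A A := subring_ideal sA.
Local Notation D := (adjoin A (t / z)).
Let sD : subring D := adjoin_subring (t / z) sA.
Let PI : is_ideal D P := chart_ideal hB.
Let htz : params A t z. Proof. by case: hB. Qed.
Let z0 : z != 0 := params_neq0 hR htz.

(** In the chart the exceptional fibre is [z = 0], since [a * t + b * z = z * (a * (t / z) + b)]. *)
Lemma horner_nonunit_coefs g : coefs_in 'm_A g -> principal D z g.[t / z].
Proof.
move=> mg; have [_ mz hm] := htz.
have Dz : D z by apply: (sub_adjoin _ sA); exact: (idealS mI mz).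
have zI : is_ideal D (principal D z).
  split.
  - by move=> _ [a Da ->]; apply: (subringM sD).
  - by exists 0; [exact: (subring0 sD) | rewrite mulr0].
  - by move=> _ _ [a Da ->] [b Db ->]; exists (a + b);
    [exact: (subringD sD) | rewrite mulrDr].
  - by move=> a _ Da [b Db ->]; exists (a * b); [exact: (subringM sD) | rewrite mulrCA].
apply: (horner_ideal sD zI); last exact: mem_adjoin.
move=> i; have [a [b [Aa Ab ->]]] := hm _ (mg i).
exists (a * (t / z) + b); last by field.
apply: (subringD sD); last exact: (sub_adjoin _ sA).
by apply: (subringM sD); [exact: (sub_adjoin _ sA) | exact: mem_adjoin].
Qed.

Let P_nonunit_coefs g : coefs_in 'm_A g -> P g.[t / z].
Proof.
move=> mg; apply: (horner_ideal sD PI); last exact: mem_adjoin.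
by apply: coefs_in_sub mg; case: hB.
Qed.

(* Over the residue field, [P] is a nonzero prime of the polynomial ring in
   [t / z]: it is generated by an element of minimal degree. *)
Lemma exceptional_generator : exists f, [/\ coefs_in A f, P f.[t / z],
  ~ coefs_in 'm_A f & forall g, coefs_in A g -> P g.[t / z] ->
    exists q r, [/\ coefs_in A q, coefs_in 'm_A r & g = q * f + r]].
Proof.
pose good n := exists f : {poly K}, [/\ size f = n, coefs_in A f, P f.[t / z] & ~ coefs_in 'm_A f].
have ex : exists n, `[< good n >].
  suff [n gn] : exists n, good n by exists n; apply/asboolP.
  have hmax : is_maximal_ideal D P by case: hB.
  have [Pt|nPt] := pselect (P (t / z)).
    exists (size ('X : {poly K})), 'X; split=> //;
      [exact: coefs_inX | by rewrite hornerX |].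
    by move=> /(_ 1%N); rewrite coefX; exact: nonunits1.
  (* An inverse of [t / z] modulo [P] yields a polynomial [1 - g * 'X] with constant coefficient [1]
     and value in [P]. *)
  have [_ [g Ag ->]] := maximal_unit sD PI hmax (mem_adjoin _ sA) nPt.
  rewrite (_ : _ - _ = (1%:P - g * 'X).[t / z]);
    last by rewrite hornerD hornerN hornerM hornerX hornerC.
  move=> Pg; exists (size (1%:P - g * 'X)), (1%:P - g * 'X); split=> //.
    apply: (coefs_inB sA AI); first exact: coefs_in1.
    by apply: (coefs_inM AI) => //; exact: coefs_inX.
  by move=> /(_ 0%N); rewrite coefB coefMX coefC subr0; exact: nonunits1.
case: (ex_minnP ex) => n /asboolP[f [sf Af Pf nf]] fmin.
have small g : coefs_in A g -> P g.[t / z] -> (size g < n)%N -> coefs_in 'm_A g.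
  move=> Ag Pg sg; apply: contrapT => ng; have /asboolP/fmin : good (size g) by exists g.
  by rewrite leqNgt sg.
have f0 : f != 0 by apply/eqP => f0; apply: nf => i; rewrite f0 coef0; exact: (ideal0 mI).
have n0 : (0 < n)%N by rewrite -sf size_poly_gt0.
(* If the leading coefficient were a nonunit, dropping the leading term would contradict the minimal
   size. *)
have nlead : ~ 'm_A f`_n.-1.
  move=> ml; apply: nf; rewrite -[f](subrK (f`_n.-1 *: 'X^(n.-1))).
  have mlX : coefs_in 'm_A (f`_n.-1 *: 'X^(n.-1)).
    by move=> i; rewrite coefZ; apply: (idealMr mI) => //; rewrite coefXn;
      case: eqP => _; [case: sA | exact: subring0].
  apply: (coefs_inD mI) => //; apply: small.
  - apply: (coefs_inB sA AI) => //; apply: coefs_in_sub mlX; exact: (idealS mI).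
  - by rewrite hornerD hornerN; apply: (idealB sD PI) => //; apply: P_nonunit_coefs.
  - rewrite -[X in (_ < X)%N](prednK n0) ltnS; apply/leq_sizeP => j jn.
    rewrite coefB coefZ coefXn; case: eqP => [->|jne]; first by rewrite mulr1 subrr.
    by rewrite mulr0 subr0 nth_default // sf; lia.
have [l0 Al] := unit_inv (Af _) nlead.
exists f; split=> // g; move: {2}(size g) (leqnn (size g)) => N.
elim: N g => [|N IHN] g sg Ag Pg.
  exists 0, 0; split; rewrite ?mul0r ?addr0; try by move=> i; rewrite coef0;
    exact: (ideal0 mI).
    by move=> i; rewrite coef0; exact: subring0.
  by apply/eqP; rewrite -size_poly_eq0 -leqn0.
have [sgn|ngs] := ltnP (size g) n.
  exists 0, g; split; [|exact: small | by rewrite mul0r add0r].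
  by move=> i; rewrite coef0; exact: subring0.
(* One step of division with remainder: [c * f] has the leading term of [g]. *)
pose c := (g`_(size g).-1 * (f`_n.-1)^-1) *: ('X^(size g - n) : {poly K}).
have Ac : coefs_in A c.
  move=> i; rewrite coefZ coefXn; apply: (subringM sA); first exact: (subringM sA).
  by case: eqP => _; [case: sA | exact: subring0].
have [|||q [r [Aq mr gE]]] := IHN (g - c * f).
- apply/leq_sizeP => j jN.
  rewrite coefB /c -scalerAl coefZ coefXnM ltnNge.
  have -> : (size g - n <= j)%N by lia.
  rewrite /=.
  have [gj|jg] := leqP (size g) j.
    have fj : f`_(j - (size g - n)) = 0 by apply: nth_default; rewrite sf; lia.
    by rewrite fj (nth_default 0 gj) mulr0 subrr.
  have -> : j = (size g).-1 by lia.
  have -> : ((size g).-1 - (size g - n) = n.-1)%N by lia.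
  by rewrite divfK // subrr.
- by apply: (coefs_inB sA AI) => //; apply: (coefs_inM AI).
- rewrite hornerD hornerN hornerM; apply: (idealB sD PI) => //; apply: (idealMl PI) => //.
  by exists c.
exists (q + c), r; split=> //; first exact: (coefs_inD AI).
by rewrite mulrDl addrAC -gE subrK.
Qed.

(** The parameters are [z], an equation of the exceptional curve, and [f.[t / z]], which generates
    [P] modulo [z]. The latter is a unit of the valuation ring because [f] has a unit coefficient,
    so that [z ^+ size f * f.[t / z]] and [z ^+ size f] have the same order. *)
Lemma exceptional_transversal : B `<=` ord_valuation_ring A ->
  exists x y, transversal (ord_valuation_ring A) B x y.
Proof.
move=> BV; have [f [Af Pf nf hf]] := exceptional_generator.
have hBl := chart_local hR hB; have sB := local_subring hBl.
have [_ mz _] := htz.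
exists z, f.[t / z]; split=> //.
- split; first exact: (dominated_nonunits hA hBl (chart_dominated hR hB)).
    exact: (chart_nonunits hR hB).
  move=> u /(chart_nonunitsP hR hB)[a [b [Pa Db nb ->]]].
  have [g Ag aE] := idealS PI Pa.
  have [q [r [Aq mr gE]]] : exists q r, [/\ coefs_in A q, coefs_in 'm_A r & g = q * f + r].
    by apply: hf => //; rewrite -aE.
  have [s Ds rE] := horner_nonunit_coefs mr.
  have Bb := chart_inv hR hB Db nb.
  exists (s * b^-1), (q.[t / z] * b^-1); split.
  + by apply: (subringM sB) => //; apply: (chart_sub hR hB).
  + by apply: (subringM sB) => //; apply: (chart_sub hR hB); exists q.
  + by rewrite aE gE hornerD hornerM rE; ring.
- exact: (nonunits_sub_valuation hR mz).
- have zf : ord_eq A (z ^+ size f * f.[t / z]) (size f) by exact: (ord_eq_form hR htz).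
  have zn : ord_eq A (z ^+ size f) (size f).
    rewrite -[z ^+ _]mulr1 -(hornerC 1 (t / z)); apply: (ord_eq_form hR htz);
      first exact: coefs_in1.
      by rewrite (leq_trans (size_polyC_leq1 _)).
    by move=> /(_ 0%N); rewrite coefC; exact: nonunits1.
  have [_] := valuation_unit hR zf zn.
  by rewrite mulrAC divff ?mul1r ?expf_neq0.
Qed.

End ExceptionalCurve.

(** * Quadratic sequences and proximity *)

Section Chains.
Variables (K : fieldType).
Implicit Types (R S T U : set K) (s : nat -> set K).

Lemma chain_dominated S T n s i j : quadratic_sequence S T n s ->
  (forall k, (k <= n)%N -> regular_local_ring 2 (s k)) ->
  (i <= j)%N -> (j <= n)%N -> dominated (s i) (s j).
Proof.
move=> [_ _ hs] hreg /subnK <-; elim: (j - i)%N => [|d IHd] dn; first exact: dominated_refl.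
apply: (dominated_trans (IHd (ltnW dn))).
by apply: (N1_dominated (hreg _ (ltnW dn))); have [] := hs _ dn.
Qed.

Lemma proximate_dominated S T : regular_local_ring 2 S -> proximate S T -> dominated S T.
Proof.
move=> hS [[ST _] TV]; split=> // u Su /TV Vu; have [->|u0] := eqVneq u 0.
  by rewrite invr0; exact: (subring0 (local_subring (regular_local hS))).
have [mu|/(unit_inv Su)[]//] := pselect ('m_S u).
by case: (inv_notin_nonunits (nonunits_sub_valuation hS mu) u0).
Qed.

Lemma proximate_mid S T U : S `<` T -> T `<=` U -> proximate S U -> proximate S T.
Proof. by move=> ST TU [_ UV]; split=> // u /TU /UV. Qed.

(** The induction starts at length one, since both parameters of [S] itself are nonunits of its
    valuation ring. In the step, [star_unique] identifies the next ring with the star of the current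
    parameters. *)
Lemma chain_transversal S T n s : (0 < n)%N -> quadratic_sequence S T n s ->
  (forall k, (k <= n)%N -> regular_local_ring 2 (s k)) ->
  T `<=` ord_valuation_ring S -> exists x y, transversal (ord_valuation_ring S) T x y.
Proof.
case: n => // n _; elim: n T => [|n IHn] T hq hreg TV.
  have [s0 sT hs] := hq; have hS : regular_local_ring 2 S by rewrite -s0; apply: hreg.
  have [t [z [P hB]]] : exists t z P, chart_point S T t z P.
    by apply/(N1P hS); rewrite -s0 -sT; have [] := hs 0%N isT.
  exact: (exceptional_transversal hS hB TV).
have [s0 sT hs] := hq; have hS : regular_local_ring 2 S by rewrite -s0; apply: hreg.
have hV := valuation_local hS.
have [sub_T N1T] : s n.+1 `<=` T /\ N1 (s n.+1) T.
  by rewrite -sT; have [[]] := hs n.+1 (leqnn _).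
have [||x [y hTr]] := IHn (s n.+1) _ _ (fun u h => TV u (sub_T u h)).
- by split=> // i ni; apply: hs; rewrite ltnW.
- by move=> k kn; apply: hreg; rewrite (leq_trans kn).
have [_ hxy _ _] := hTr.
have hreg' : regular_local_ring 2 (s n.+1) by apply: hreg.
exists (x / y), y; rewrite (star_unique hreg' hxy hV hTr N1T TV).
exact: star_transversal.
Qed.

End Chains.

(** * Clusters and the intersection matrix *)

Lemma residue_degree_dominated (K : fieldType) (R T B : set K) :
  local_ring T -> local_ring B -> R `<=` T -> dominated T B ->
  (forall u, B u -> exists a, T a /\ 'm_B (u - a)) ->
  residue_degree R T = residue_degree R B.
Proof.
move=> hT hB RT dTB hres; have [TB _] := dTB.
have [sT sB] := (local_subring hT, local_subring hB).
have [mTI mBI] := (nonunits_ideal hT, nonunits_ideal hB).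
have mTB u : 'm_T u -> 'm_B u by exact: dominated_nonunits.
have mBT u : T u -> 'm_B u -> 'm_T u.
  by move=> Tu mu; apply: contrapT => nu; apply: (unit_sub hT TB Tu nu).
(* Both degrees are [xget] of a set of basis sizes, so it suffices that the sets agree. A basis for
   [T] serves for [B]; one for [B] is approximated modulo ['m_B] by elements of [T]. *)
rewrite /residue_degree; congr xget; apply/seteqP; split=> n [e [eT egen eind]].
- exists e; split=> [i|u Bu|a Ra Ba]; first exact: TB.
    have [b [Tb mub]] := hres u Bu; have [a Ra mba] := egen b Tb.
    exists a => //;
      have -> : u - \sum_i a i * e i = (u - b) + (b - \sum_i a i * e i) by ring.
    by apply: (idealD mBI) => //; apply: mTB.
  apply: eind => //; apply: mBT => //; apply: (ideal_sum (subring_ideal sT)) => i _.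
  by apply: (subringM sT) => //; apply: RT.
- have /fin_all_exists[f hf] : forall i, exists a, T a /\ 'm_B (e i - a) by move=> i;
  apply: hres.
  have diff (a : 'I_n -> K) : (forall i, R (a i)) -> 'm_B (\sum_i a i * e i - \sum_i a i * f i).
    move=> Ra; rewrite -sumrB; apply: (ideal_sum mBI) => i _; rewrite -mulrBr.
    by apply: (idealMl mBI); [exact/TB/RT | case: (hf i)].
  have Tsum (a : 'I_n -> K) : (forall i, R (a i)) -> T (\sum_i a i * f i).
    move=> Ra; apply: (ideal_sum (subring_ideal sT)) => i _.
    by apply: (subringM sT); [exact: RT | case: (hf i)].
  exists f; split=> [i|u Tu|a Ra Ta]; first by case: (hf i).
    have [a Ra mua] := egen u (TB u Tu); exists a => //; apply: mBT.
      by case: (sT) => _ TBB _; apply: TBB => //; apply: Tsum.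
    have -> : u - \sum_i a i * f i =
      (u - \sum_i a i * e i) + (\sum_i a i * e i - \sum_i a i * f i) by ring.
    by apply: (idealD mBI) => //; apply: diff.
  apply: eind => //; rewrite -(subrK (\sum_i a i * f i) (\sum_i a i * e i)).
  by apply: (idealD mBI); [exact: diff | exact: mTB].
Qed.

Lemma proper_sub_trans (T : Type) (A B C : set T) : A `<` B -> B `<=` C -> A `<` C.
Proof. by move=> [AB nBA] BC; split=> [u /AB /BC //|CA]; apply: nBA => u /BC /CA. Qed.

(** * Proximity within a cluster and the entries of the matrix *)

Section Clusters.
Variables (K : fieldType) (R : set K) (C : {fset set K}).
Hypothesis hC : cluster R C.
Implicit Types S T U : set K.

Lemma cluster_regular T : T \in C -> regular_local_ring 2 T.
Proof. by case: hC => + _ _ => /[apply] -[]. Qed.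

Lemma cluster_sub T : T \in C -> R `<=` T.
Proof. by case: hC => + _ _ => /[apply] -[]. Qed.

Lemma chain_through S U m s : S \in C -> U \in C -> proximate S U ->
  quadratic_sequence R U m s -> (forall i, (i <= m)%N -> s i \in C) ->
  exists2 j, (j < m)%N & s j = S.
Proof.
move=> SC UC SU hs sC; have [_ _ hch] := hC.
have [n [r [hr rC]]] := hch S SC.
have [[r0 rS hr'] [s0 sU hs']] := (hr, hs).
have reg_r k : (k <= n)%N -> regular_local_ring 2 (r k) by move/rC/cluster_regular.
have reg_s k : (k <= m)%N -> regular_local_ring 2 (s k) by move/sC/cluster_regular.
have hU := regular_local (cluster_regular UC).
have dSU := proximate_dominated (cluster_regular SC) SU.
(* [U] dominates the members of both sequences, so [N1_unique] makes them agree as long as both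
   run. *)
have rs i : (i <= n)%N -> (i <= m)%N -> r i = s i.
  elim: i => [|i IHi] ni mi; first by rewrite r0 s0.
  have [_ Nr] := hr' i ni; have [_ Ns] := hs' i mi.
  have ri := IHi (ltnW ni) (ltnW mi).
  rewrite -ri in Ns.
  apply: (N1_unique (reg_r i (ltnW ni)) hU Nr Ns).
    by apply: (dominated_trans _ dSU); rewrite -rS; apply: (chain_dominated hr).
  by rewrite -sU; apply: (chain_dominated hs).
(* If the sequence of [U] were not the longer one, [U] would be contained in [S]. *)
have [mn|nm] := leqP m n; last by exists n => //; rewrite -rs // ltnW.
have [[_ nUS] _] := SU; case: nUS.
rewrite -sU -rs // -rS; have [] // := chain_dominated hr reg_r mn (leqnn n).
Qed.

Lemma proximate_comparable S T U : S \in C -> T \in C -> U \in C -> S <> T ->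
  proximate S U -> proximate T U -> proximate S T \/ proximate T S.
Proof.
move=> SC TC UC ST SU TU; have [_ _ hch] := hC.
have [m [s [hs sC]]] := hch U UC.
have reg_s k : (k <= m)%N -> regular_local_ring 2 (s k) by move/sC/cluster_regular.
have [i im si] := chain_through SC UC SU hs sC.
have [j jm sj] := chain_through TC UC TU hs sC.
have lt_prox k l : (k < l)%N -> (l < m)%N -> proximate (s k) U -> proximate (s k) (s l).
  move=> kl lm; have [_ sU hs'] := hs.
  have [lt1 _] := hs' k (ltn_trans kl lm).
  have [sub2 _] := chain_dominated hs reg_s kl (ltnW lm).
  have [sub3 _] := chain_dominated hs reg_s (ltnW lm) (leqnn m).
  apply: proximate_mid; last by rewrite -sU.
  exact: (proper_sub_trans lt1).
case: (ltngtP i j) => [ij|ji|ij].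
- by left; rewrite -si -sj; apply: lt_prox => //; rewrite si.
- by right; rewrite -si -sj; apply: lt_prox => //; rewrite sj.
- by case: ST; rewrite -si -sj ij.
Qed.

Lemma proximate_star S T : S \in C -> T \in C -> proximate S T ->
  exists Tstar, [/\ unique (fun U => N1 T U /\ proximate S U) Tstar,
    proximate T Tstar, residue_degree R T = residue_degree R Tstar
    & forall U, U \in C -> proximate S U -> proximate T U -> U = Tstar].
Proof.
move=> SC TC ST; have [_ _ hch] := hC.
have [hS hT] := (cluster_regular SC, cluster_regular TC).
have [hV hW] := (valuation_local hS, valuation_local hT).
have [x [y hTr]] : exists x y, transversal (ord_valuation_ring S) T x y.
  have [n [s [hs sC]]] := hch T TC.
  have [j jn sj] := chain_through SC TC ST hs sC.
  (* The sequence from [R] to [T] passes through [S] at index [j]; its tail from there is used. *)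
  apply: (@chain_transversal _ S T (n - j) (fun i => s (j + i)%N)).
  - by rewrite subn_gt0.
  - have [s0 sT hs'] := hs; split; rewrite ?addn0 ?subnKC // 1?ltnW //.
    by move=> i ij; rewrite addnS; apply: hs'; lia.
  - by move=> k kn; apply/cluster_regular/sC; lia.
  - by case: ST.
have [TV hxy _ _] := hTr.
have lt_star := star_proper hT hxy; have [sub_star _] := lt_star.
have starV : star T x y `<=` ord_valuation_ring S by have [] := star_transversal hT hxy hV hTr.
have S_star : proximate S (star T x y).
  by split=> //; case: ST => ltST _; exact: (proper_sub_trans ltST).
have T_star : proximate T (star T x y).
  by split=> //; have [] := star_transversal_exceptional hT hxy.
exists (star T x y); split=> //.
- split; first by split=> //; exact: star_N1.
  by move=> B [NB [_ BV]]; rewrite (star_unique hT hxy hV hTr NB BV).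
- apply: residue_degree_dominated => //.
  + exact: regular_local.
  + exact: star_local.
  + exact: cluster_sub.
  + exact: (N1_dominated hT (star_N1 hT hxy)).
  + exact: star_residue.
- move=> U UC SU TU; have [n [s [hs sC]]] := hch U UC.
  have [j jn sj] := chain_through TC UC TU hs sC.
  have reg_s k : (k <= n)%N -> regular_local_ring 2 (s k) by move/sC/cluster_regular.
  have [s0 sU hs'] := hs.
  have sub k : (k <= n)%N -> s k `<=` U.
    by move=> kn; rewrite -sU; have [] := chain_dominated hs reg_s kn (leqnn n).
  have subV k : (k <= n)%N -> s k `<=` ord_valuation_ring S.
    by move=> kn; apply: (subset_trans (sub k kn)); case: SU.
  have subW k : (k <= n)%N -> s k `<=` ord_valuation_ring T.
    by move=> kn; apply: (subset_trans (sub k kn)); case: TU.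
  (* The sequence of [U] passes through [T], and its next member lies in the valuation ring of
     [S]. *)
  have sj1 : s j.+1 = star T x y.
    apply: (star_unique hT hxy hV hTr); last exact: subV.
    by rewrite -sj; have [] := hs' j jn.
  have [eq_n|lt_n] := leqP n j.+1; first by rewrite -sj1 -sU; congr s; lia.
  (* A further member would be a quadratic transform of the star inside both valuation rings, for
     which the parameters of the star are transversal in opposite orders. *)
  have [_ Nj] := hs' j.+1 lt_n; rewrite sj1 in Nj.
  have hstar : regular_local_ring 2 (star T x y) by rewrite -sj1; apply: reg_s; exact: ltnW.
  case: (transversal_separated hstar hV hW (star_transversal hT hxy hV hTr)
    (star_transversal_exceptional hT hxy) Nj).
  by split; [exact: subV | exact: subW].
Qed.

Let deg (U : C) : int := (residue_degree R (fsval U))%:Z.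
Let prox (S T : C) : bool := `[< proximate (fsval S) (fsval T) >].
Let coef (S T : C) : int := if S == T then 1 else if prox S T then -1 else 0.

Let prox_asym (S T : C) : prox S T -> prox T S = false.
Proof. by move=> /asboolP[[_ nTS] _]; apply/asboolP => -[[]]. Qed.

Let prox_irrefl (S : C) : prox S S = false.
Proof. by apply/negP => /[dup] /prox_asym ->. Qed.

Lemma intersection_entryE (S T : C) :
  intersection_entry R S T = - \sum_(U : C) coef S U * deg U * coef T U.
Proof.
have proxE (U V : C) : proximity_matrix C (enum_rank U) (enum_rank V) = coef U V.
  by rewrite mxE /pt !enum_rankK.
rewrite /intersection_entry /intersection_matrix /degree_matrix mul_mx_diag !mxE.
congr (- _); rewrite (reindex enum_rank) /=; last first.
  by apply: onW_bij; exact: enum_rank_bij.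
by apply: eq_bigr => U _; rewrite !mxE -!proxE !mxE /deg /pt !enum_rankK.
Qed.

Lemma intersection_entry_sym (S T : C) : intersection_entry R S T = intersection_entry R T S.
Proof. by rewrite !intersection_entryE; congr (- _); apply: eq_bigr => U _; ring. Qed.

Lemma intersection_entry_diag (S : C) :
  intersection_entry R S S = - (deg S + \sum_(U | prox S U) deg U).
Proof.
rewrite intersection_entryE; congr (- _).
rewrite -[in RHS](big_pred1_eq +%R S deg).
rewrite [in RHS]big_mkcond [X in _ = _ + X]big_mkcond -big_split /=.
apply: eq_bigr => U _; rewrite /coef eq_sym.
case: (eqVneq U S) => [->|_]; first by rewrite prox_irrefl; ring.
by case: (prox S U); ring.
Qed.

(** Before the global sign, [U = T] contributes [- deg T], [U = S] contributes zero as [S] is not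
    proximate to [T], and a point proximate to both contributes its degree. *)
Lemma intersection_entry_proximate (S T : C) : prox S T ->
  intersection_entry R S T = deg T - \sum_(U | prox S U && prox T U) deg U.
Proof.
move=> ST; rewrite intersection_entryE.
have nTS := prox_asym ST.
rewrite -[in RHS](big_pred1_eq +%R T deg).
rewrite [in RHS]big_mkcond [X in _ = _ - X]big_mkcond -sumrB -sumrN /=.
apply: eq_bigr => U _; rewrite /coef [S == U]eq_sym [T == U]eq_sym.
have [->|UT] := eqVneq U T.
  have -> : T == S = false by apply/eqP => TS; move: ST; rewrite TS prox_irrefl.
  by rewrite ST prox_irrefl /=; ring.
have [->|US] := eqVneq U S; first by rewrite nTS prox_irrefl /=; ring.
by case: (prox S U); case: (prox T U) => /=; ring.
Qed.

(** By [proximate_star] only [Tstar] could be proximate to both points, so the sum over the cluster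
    is empty. *)
Lemma intersection_entry_notin (S T : C) :
  proximate_star_notin C (fsval S) (fsval T) -> intersection_entry R S T = deg T.
Proof.
move=> [ST [Tstar [Tuniq TsC]]].
rewrite intersection_entry_proximate; last exact/asboolP.
rewrite big_pred0 ?subr0 // => U; apply/negP => /andP[/asboolP SU /asboolP TU].
have [V [Vuniq TV _ hV]] := proximate_star (valP S) (valP T) ST.
have [hTs _] := Tuniq; have [_ /(_ _ hTs) VE] := Vuniq.
by move: TsC; rewrite -VE -(hV _ (valP U) SU TU) (valP U).
Qed.

(** The sum has the single term belonging to [V], the point [T*]; it has the degree of [T] and
    cancels [deg T]. *)
Lemma intersection_entry_in (S T : C) : proximate (fsval S) (fsval T) ->
  ~ proximate_star_notin C (fsval S) (fsval T) -> intersection_entry R S T = 0.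
Proof.
move=> ST nst; have [V [Vuniq TV degV hV]] := proximate_star (valP S) (valP T) ST.
have VC : V \in C by apply: contrapT => /negP nVC; apply: nst; split=> //; exists V.
have [[_ SV] _] := Vuniq.
rewrite intersection_entry_proximate; last exact/asboolP.
rewrite (big_pred1 [` VC]%fset) => [|U]; first by rewrite /deg degV subrr.
apply/andP/eqP => [[/asboolP SU /asboolP TU]|->]; last by split; apply/asboolP.
by apply: val_inj; exact: hV (valP U) SU TU.
Qed.

(** A nonzero term would come from a point proximate to both, against [proximate_comparable]; at
    [U = S] or [U = T] one of the factors vanishes. *)
Lemma intersection_entry_unrelated (S T : C) : S <> T ->
  ~ proximate (fsval S) (fsval T) -> ~ proximate (fsval T) (fsval S) ->
  intersection_entry R S T = 0.
Proof.
move=> ST nST nTS; rewrite intersection_entryE big1 ?oppr0 // => U _.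
rewrite /coef; have [<-|_] := eqVneq S U.
  case: eqVneq => [TS|_]; first by case: ST.
  by rewrite /prox asboolF // mulr0.
have [<-|_] := eqVneq T U; first by rewrite /prox asboolF // !mul0r.
have [/asboolP SU|_] := boolP (prox S U); last by rewrite !mul0r.
have [/asboolP TU|_] := boolP (prox T U); last by rewrite mulr0.
have ST' : fsval S <> fsval T by move/val_inj.
by case: (proximate_comparable (valP S) (valP T) (valP U) ST' SU TU).
Qed.

End Clusters.

Theorem theorem4p8 (K : fieldType) (R : set K) (C : {fset set K})
  (hR : regular_local_ring 2 R) (hK : fraction_field R) (hC : cluster R C)
  (S T : C) :
  [/\ S = T ->
        intersection_entry R S T =
        - ((residue_degree R (fsval S))%:Z
           + \sum_(U : C | `[< proximate (fsval S) (fsval U) >])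
               (residue_degree R (fsval U))%:Z),
      proximate_star_notin C (fsval S) (fsval T) ->
        intersection_entry R S T = (residue_degree R (fsval T))%:Z,
      proximate_star_notin C (fsval T) (fsval S) ->
        intersection_entry R S T = (residue_degree R (fsval S))%:Z
    & S <> T ->
      ~ proximate_star_notin C (fsval S) (fsval T) ->
      ~ proximate_star_notin C (fsval T) (fsval S) ->
        intersection_entry R S T = 0].
Proof.
split.
- by move=> <-; exact: intersection_entry_diag.
- exact: intersection_entry_notin.
- by rewrite intersection_entry_sym; exact: intersection_entry_notin.
- move=> ST nST nTS.
  have [pST|npST] := pselect (proximate (fsval S) (fsval T)).
    exact: intersection_entry_in.
  have [pTS|npTS] := pselect (proximate (fsval T) (fsval S)).
    by rewrite intersection_entry_sym; exact: intersection_entry_in.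
  exact: intersection_entry_unrelated.
Qed.
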